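(* Let $u$ be the weak solution of the parabolic problem $\partial_t u-\nabla\cdot(a\nabla u)=f$ in $\Omega\times(0,T]$, $u(0)=u_0$, $u|_{\partial\Omega}=0$, and let $U\in C^{0,1}(0,T;S)$ be the solution of the spatially semidiscrete DG scheme $$\langle\partial_t U,V\rangle+B(U,V)=\langle f,V\rangle\quad\text{for all }V\in S,\ t\in[0,T].$$ Let $w(t)\in H^1_0(\Omega)$ be the elliptic reconstruction of $U(t)$, $t\in[0,T]$. Assume that the DG bilinear form $B$ and the DG norm $|||\cdot|||$ on $\mathcal S=S+H^1_0(\Omega)$ satisfy, for all $t$ and all $v,z\in H^1_0(\Omega)$, $$B(v,z)=\int_\Omega (a(\cdot,t)\nabla v)\cdot\nabla z,\qquad |||v|||=\|\sqrt{a(\cdot,t)}\,\nabla v\|,$$ and that a decomposition $U=U_c+U_d$ with $U_c\in S\cap H^1_0(\Omega)$ and $U_d=U-U_c\in S$ is available. Then $$\|u-U\|_{L_2(0,T;\mathcal S)}\le (\sqrt{3/2}+1)\|w-U\|_{L_2(0,T;\mathcal S)}+\sqrt{3/2}\,\|U_d\|_{L_2(0,T;\mathcal S)}+2\|\partial_tU_d\|_{L^1(0,T;L_2(\Omega))}+\sqrt2\,\|u_0-U_c(0)\|.$$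
   Context: Setting. $\Omega\subset\mathbb R^d$, $d\in\{2,3\}$, is an open (possibly curvilinear) polygonal domain, $T>0$, $f\in L_\infty(0,T;L_2(\Omega))$ is piecewise continuous in time with finitely many time-discontinuities, and $a\in L_\infty(\Omega\times(0,T))^{d\times d}$ is symmetric positive definite almost everywhere, uniformly elliptic (the infimum and supremum of $(a(x,t)\zeta)\cdot\zeta/|\zeta|^2$ over $\zeta\ne0$ and $(x,t)$ are positive real numbers) and continuous in time, with spatial discontinuities aligned with the mesh. The weak solution $u$ satisfies $u\in C(0,T;H^1_0(\Omega))$, $\partial_tu\in L_2(0,T;L_2(\Omega))$ and $\langle\partial_tu,v\rangle+\int_\Omega (a\nabla u)\cdot\nabla v=\langle f,v\rangle$ for all $v\in H_0^1(\Omega)$. Notation. $\|\cdot\|$ and $\langle\cdot,\cdot\rangle$ are the norm and inner product of $L_2(\Omega)$. Discrete space. $\mathcal T$ is a (time-independent) subdivision of $\Omega$ into disjoint open elements $\kappa$ with diffeomorphisms $F_\kappa:\hat\kappa\to\kappa$, $\hat\kappa$ the reference simplex or cube, and for fixed $p\ge1$, $S=\{v\in L_2(\Omega): v|_\kappa\circ F_\kappa\in\mathcal P_p(\hat\kappa)\ \forall\kappa\in\mathcal T\}$, where $\mathcal P_p$ denotes polynomials of degree $p$ (of degree $p$ in each variable on the cube). For each $t$, $B=B(t;\cdot,\cdot):\mathcal S\times\mathcal S\to\mathbb R$ is a bilinear form and $|||\cdot|||$ (also depending on $t$) is a norm on $\mathcal S=S+H_0^1(\Omega)$; the $t$-dependence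 is suppressed. Define $\|v\|_{L_2(0,T;\mathcal S)}=\big(\int_0^T|||v(t)|||^2\,dt\big)^{1/2}$ and $\|v\|_{L^1(0,T;L_2(\Omega))}=\int_0^T\|v(t)\|\,dt$. Elliptic reconstruction. Let $\Pi:L_2(\Omega)\to S$ be the $L_2$-orthogonal projection and, for each $t$, $A:S\to S$ the operator defined by $\langle AZ,V\rangle=B(Z,V)$ for all $V\in S$. The elliptic reconstruction $w(t)\in H^1_0(\Omega)$ of $U(t)$ is the solution of $B(w,v)=\langle AU-\Pi f+f,v\rangle$ for all $v\in H^1_0(\Omega)$. Decomposition. No particular choice of the conforming part $U_c$ and nonconforming part $U_d$ is specified. *)

(* Defs.v *)
From HB Require Import structures.
From mathcomp Require Import all_boot all_order all_algebra.
From mathcomp Require Import all_classical all_reals all_analysis.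
Set Implicit Arguments.
Unset Strict Implicit.
Unset Printing Implicit Defensive.
Import Order.TTheory GRing.Theory Num.Theory.
Import numFieldNormedType.Exports.
Local Open Scope classical_set_scope.
Local Open Scope ring_scope.

(* Product (= Borel) sigma-algebra on R^n, generated by the coordinates, in the
   same way as the library's instance on n.-tuple T. *)
Section measurable_rV.
Context {R : realType} (n : nat).
Let coord (i : 'I_n) (x : 'rV[R]_n) : R := x ord0 i.
Let rV_set0 : g_sigma_preimage coord set0. Proof. exact: sigma_algebra0. Qed.
Let rV_setC A : g_sigma_preimage coord A -> g_sigma_preimage coord (~` A).
Proof. exact: sigma_algebraC. Qed.
Let rV_bigcup (F : (set 'rV[R]_n)^nat) : (forall i, g_sigma_preimage coord (F i)) ->
  g_sigma_preimage coord (\bigcup_i (F i)).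
Proof. exact: sigma_algebra_bigcup. Qed.
HB.instance Definition _ := @isMeasurable.Build
  (measure_tuple_display default_measure_display)
  'rV[R]_n (g_sigma_preimage coord) rV_set0 rV_setC rV_bigcup.
End measurable_rV.

Lemma measurable_rV_coord (R : realType) n (i : 'I_n) :
  measurable_fun [set: 'rV[R]_n] (fun x => x ord0 i).
Proof.
move=> _ Y mY; rewrite setTI; apply: sub_sigma_algebra => /=.
rewrite -bigcup_seq/=; exists i => /=; first by rewrite mem_index_enum.
by exists Y => //; rewrite setTI.
Qed.

Lemma measurable_fun_rVP (R : realType) d (X : measurableType d) n
    (f : X -> 'rV[R]_n) :
  (forall i, measurable_fun [set: X] (fun x => f x ord0 i)) ->
  measurable_fun [set: X] f.
Proof.
move=> mf _ A; rewrite setTI.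
pose G := [set B : set 'rV[R]_n | measurable (f @^-1` B)].
suff : g_sigma_preimage (fun i (x : 'rV[R]_n) => x ord0 i : R) `<=` G by exact.
apply: smallest_sub => /=.
  split => [|B mB|F mF] /=.
  - by rewrite /G /= preimage_set0.
  - by rewrite /G /= setTD -preimage_setC; exact: measurableC.
  - by rewrite /G /= preimage_bigcup; exact: bigcupT_measurable.
rewrite -bigcup_seq => B [i _ [C mC <-]]; rewrite /G /= setTI.
by have := mf i measurableT C mC; rewrite setTI.
Qed.

Definition rV_cons (R : realType) n (p : measurableTypeR R * 'rV[R]_n) : 'rV[R]_n.+1 :=
  \row_i oapp (fun j => p.2 ord0 j) p.1 (unlift ord0 i).

Lemma rV_cons0 (R : realType) n (p : measurableTypeR R * 'rV[R]_n) :
  rV_cons p ord0 ord0 = p.1.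
Proof. by rewrite mxE unlift_none. Qed.

Lemma rV_consS (R : realType) n (p : measurableTypeR R * 'rV[R]_n) j :
  rV_cons p ord0 (lift ord0 j) = p.2 ord0 j.
Proof. by rewrite mxE liftK. Qed.

Lemma measurable_rV_cons (R : realType) n :
  measurable_fun [set: measurableTypeR R * 'rV[R]_n] (@rV_cons R n).
Proof.
apply: measurable_fun_rVP => i; case: (unliftP ord0 i) => [j ->|->].
- under eq_fun do rewrite rV_consS.
  apply: (@measurableT_comp _ _ _ _ _ _ (fun x : 'rV[R]_n => x ord0 j)) => //.
  exact: measurable_rV_coord.
- by under eq_fun do rewrite rV_cons0; exact: measurable_fst.
Qed.

(* lebS m is the product of the Lebesgue measure on R with m, transported along
   rV_cons; leb R n is therefore the n-dimensional Lebesgue measure. *)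
Section lebS.
Context {R : realType} (n : nat).
Variable m : {sigma_finite_measure set 'rV[R]_n -> \bar R}.
Local Open Scope ereal_scope.
Definition lebS : set 'rV[R]_n.+1 -> \bar R :=
  pushforward (lebesgue_measure \x m) (@rV_cons R n).

Let mcons A : measurable A -> measurable (@rV_cons R n @^-1` A).
Proof.
by move=> mA; rewrite -[X in measurable X]setTI; exact: measurable_rV_cons.
Qed.
Let lebS0 : lebS set0 = 0.
Proof. by rewrite /lebS /pushforward preimage_set0 measure0. Qed.
Let lebS_ge0 A : 0 <= lebS A. Proof. by rewrite /lebS /pushforward measure_ge0. Qed.
Let lebS_sigma_additive : semi_sigma_additive lebS.
Proof.
move=> F mF tF mUF; rewrite /lebS /pushforward preimage_bigcup.
apply: measure_semi_sigma_additive.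
- by move=> k; exact: mcons.
- apply/trivIsetP => /= i j _ _ ij; rewrite -preimage_setI.
  by move/trivIsetP : tF => /(_ _ _ _ _ ij) ->//; rewrite preimage_set0.
- by rewrite -preimage_bigcup; exact: mcons.
Qed.
HB.instance Definition _ := isMeasure.Build _ _ _ lebS
  lebS0 lebS_ge0 lebS_sigma_additive.

Let lebS_sigma_finite : sigma_finite setT lebS.
Proof.
pose behead (x : 'rV[R]_n.+1) : measurableTypeR R * 'rV[R]_n :=
  (x ord0 ord0, \row_j x ord0 (lift ord0 j)).
have mbehead : measurable_fun [set: 'rV[R]_n.+1] behead.
  apply: measurable_fun_pair; first exact: measurable_rV_coord.
  apply: measurable_fun_rVP => i; under eq_fun do rewrite mxE.
  exact: measurable_rV_coord.
have beheadK : cancel (@rV_cons R n) behead.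
  move=> [a y]; rewrite /behead rV_cons0; congr pair.
  by apply/rowP => j; rewrite mxE rV_consS.
have /sigma_finiteP[F [TF ndF Foo]] := sigma_finiteT (@lebesgue_measure R).
have /sigma_finiteP[G [TG ndG Goo]] := sigma_finiteT m.
exists (fun k => behead @^-1` (F k `*` G k)) => [|k].
  rewrite -preimage_bigcup (_ : \bigcup_k _ = setT) ?preimage_setT//.
  rewrite -setXTT TF TG predeqE => -[x y]; split.
    by move=> [k _ []/= ? ?]; split; exists k.
  move=> [/= [k _ Fkx] [l _ Gly]]; exists (maxn k l) => //; split.
  - by move: x Fkx; exact/subsetPset/ndF/leq_maxl.
  - by move: y Gly; exact/subsetPset/ndG/leq_maxr.
have [? ?] := Foo k; have [? ?] := Goo k.
split.
  by rewrite -[X in measurable X]setTI; apply: mbehead => //; exact: measurableX.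
rewrite /lebS /pushforward -comp_preimage (_ : behead \o _ = id).
  by rewrite preimage_id product_measure1E// lte_mul_pinfty// ge0_fin_numE.
by apply/funext => x /=; exact: beheadK.
Qed.
HB.instance Definition _ := Measure_isSigmaFinite.Build _ _ _ lebS
  lebS_sigma_finite.
End lebS.

Fixpoint leb (R : realType) (n : nat) :
    {sigma_finite_measure set 'rV[R]_n -> \bar R} :=
  match n with
  | 0 => \d_(0 : 'rV[R]_0)
  | n.+1 => lebS (leb R n)
  end.

Section calculus.
Context {R : realType} (d : nat).
Implicit Types (v z : 'rV[R]_d -> R) (g : 'rV[R]_d -> 'rV[R]_d).

Definition dotv n (x y : 'rV[R]_n) : R := \sum_i x ord0 i * y ord0 i.

(* Points and gradients are row vectors, so the product of the matrix M with
   the vector z is z *m M^T. *)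
Definition actv (M : 'M[R]_d) (z : 'rV[R]_d) : 'rV[R]_d := z *m M^T.

Definition partial (i : 'I_d) v : 'rV[R]_d -> R := 'D_(delta_mx ord0 i) v.

Definition gradv v : 'rV[R]_d -> 'rV[R]_d := fun x => \row_i partial i v x.

Fixpoint Ck k v : Prop :=
  if k is k'.+1 then
    (forall x, differentiable v x) /\ (forall i, Ck k' (partial i v))
  else continuous v.

Definition test_fun (Omega : set 'rV[R]_d) v : Prop :=
  (forall k, Ck k v) /\
  exists K, [/\ compact K, K `<=` Omega & forall x, ~ K x -> v x = 0].

Definition C1_on n m (A : set 'rV[R]_n) (F : 'rV[R]_n -> 'rV[R]_m) : Prop :=
  (forall x, A x -> differentiable F x) /\
  (forall i x, A x -> {for x, continuous ('D_(delta_mx ord0 i) F)}).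

Definition diffeo (A B : set 'rV[R]_d) (F : 'rV[R]_d -> 'rV[R]_d) : Prop :=
  C1_on A F /\ F @` A = B /\
  exists G, [/\ C1_on B G, G @` B = A, {in A, cancel F G} & {in B, cancel G F}].

End calculus.

Section domain.
Context {R : realType} (d : nat).

Definition ref_simplex n : set 'rV[R]_n :=
  [set x | (forall i, 0 < x ord0 i) /\ \sum_i x ord0 i < 1].

Definition ref_cube n : set 'rV[R]_n :=
  [set x | forall i, 0 < x ord0 i < 1].

(* A curvilinear facet is the image of the closed reference (d-1)-simplex under
   a C^1 embedding; affine embeddings give the usual polygonal domains. *)
Definition facet (gam : 'rV[R]_d.-1 -> 'rV[R]_d) : Prop :=
  exists O : set 'rV[R]_d.-1,
    [/\ open O, closure (ref_simplex (n := d.-1)) `<=` O, C1_on O gam,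
        {in closure (ref_simplex (n := d.-1)) &, injective gam} &
        forall x h, closure (ref_simplex (n := d.-1)) x ->
          'd gam x h = 0 -> h = 0].

Definition polygonal_domain (Omega : set 'rV[R]_d) : Prop :=
  [/\ open Omega, connected Omega, bounded_set Omega, Omega !=set0 &
   exists (m : nat) (gam : 'I_m -> 'rV[R]_d.-1 -> 'rV[R]_d),
     (forall j, facet (gam j)) /\
     closure Omega `\` Omega =
       \bigcup_j (gam j @` closure (ref_simplex (n := d.-1)))].

Inductive ref_shape := Simplex | Cube.

Definition ref_elt (s : ref_shape) : set 'rV[R]_d :=
  match s with Simplex => ref_simplex (n := d) | Cube => ref_cube (n := d) end.

(* The total degree is bounded by p on the simplex, the degree in each variable
   on the cube. *)
Definition poly_fun (s : ref_shape) (p : nat) (q : 'rV[R]_d -> R) : Prop :=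
  exists c : {ffun 'I_d -> 'I_p.+1} -> R, forall x,
    q x = \sum_(al : {ffun 'I_d -> 'I_p.+1} | match s with
                     | Simplex => (\sum_i al i <= p)%N
                     | Cube => true
                     end) c al * \prod_i x ord0 i ^+ al i.

Record mesh (Omega : set 'rV[R]_d) := Mesh {
  nelt : nat ;
  elt : 'I_nelt -> set 'rV[R]_d ;
  elt_shape : 'I_nelt -> ref_shape ;
  elt_map : 'I_nelt -> 'rV[R]_d -> 'rV[R]_d ;
  elt_open : forall k, open (elt k) ;
  elt_sub : forall k, elt k `<=` Omega ;
  elt_disj : trivIset setT elt ;
  elt_cover : closure Omega = \bigcup_k closure (elt k) ;
  elt_full : (leb R d).-negligible (Omega `\` \bigcup_k elt k) ;
  elt_diffeo : forall k, diffeo (ref_elt (elt_shape k)) (elt k) (elt_map k)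
}.

End domain.
Arguments nelt {R d Omega}.
Arguments elt {R d Omega}.
Arguments elt_shape {R d Omega}.
Arguments elt_map {R d Omega}.

(* Elements of L_2(Omega) are represented by measurable functions on R^d; only
   their values on Omega matter, and they are identified by eq_on. *)
Section spaces.
Context {R : realType} (d : nat) (Omega : set 'rV[R]_d).
Local Notation mu := (leb R d).
Local Notation fn := ('rV[R]_d -> R).
Implicit Types (v z : 'rV[R]_d -> R) (g h : 'rV[R]_d -> 'rV[R]_d).

Definition eq_on v z : Prop := {ae mu, forall x, Omega x -> v x = z x}.

Definition L2 v : Prop :=
  measurable_fun Omega v /\ (\int[mu]_(x in Omega) ((v x) ^+ 2)%:E < +oo)%E.

Definition ip v z : R := \int[mu]_(x in Omega) (v x * z x).

Definition L2norm v : R := Num.sqrt (ip v v).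

Definition L2vec g : Prop := forall i, L2 (fun x => g x ord0 i).

Definition L2norm_vec g : R := Num.sqrt (\int[mu]_(x in Omega) dotv (g x) (g x)).

(* H10grad v g: v belongs to the closure of C_c^infty(Omega) in H^1(Omega), and
   g is its gradient. *)
Definition H10grad v g : Prop :=
  [/\ L2 v, L2vec g &
   exists phi : nat -> fn,
     [/\ forall n, test_fun Omega (phi n),
         L2norm (phi n \- v) @[n --> \oo] --> (0 : R) &
         L2norm_vec (gradv (phi n) \- g) @[n --> \oo] --> (0 : R)]].

Definition H10 v : Prop := exists g, H10grad v g.

Definition aform (M : 'rV[R]_d -> 'M[R]_d) g h : R :=
  \int[mu]_(x in Omega) dotv (actv (M x) (g x)) (h x).

Section finite_element_space.
Variables (Th : mesh Omega) (p : nat).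

Definition Sh v : Prop :=
  L2 v /\ forall k, exists2 q, poly_fun (elt_shape Th k) p q &
    {ae mu, forall x, ref_elt (elt_shape Th k) x -> v (elt_map Th k x) = q x}.

(* the sum S + H^1_0(Omega) *)
Definition SH v : Prop :=
  L2 v /\ exists s z, [/\ Sh s, H10 z & eq_on v (s \+ z)].

Definition bilinear_on (B : fn -> fn -> R) : Prop :=
  [/\ forall v v' z z', SH v -> SH v' -> SH z -> SH z' ->
        eq_on v v' -> eq_on z z' -> B v z = B v' z',
      forall c v v' z, SH v -> SH v' -> SH z ->
        B (fun x => c * v x + v' x) z = c * B v z + B v' z &
      forall c v z z', SH v -> SH z -> SH z' ->
        B v (fun x => c * z x + z' x) = c * B v z + B v z'].

Definition norm_on (N : fn -> R) : Prop :=
  [/\ forall v v', SH v -> SH v' -> eq_on v v' -> N v = N v',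
      forall v, SH v -> 0 <= N v,
      forall v, SH v -> N v = 0 -> eq_on v (fun=> 0),
      forall c v, SH v -> N (fun x => c * v x) = `|c| * N v &
      forall v z, SH v -> SH z -> N (v \+ z) <= N v + N z].

Definition L2proj (Pi : fn -> fn) : Prop :=
  forall v, L2 v -> Sh (Pi v) /\ forall V, Sh V -> ip (Pi v) V = ip v V.

Definition discrete_op (B : fn -> fn -> R) (A : fn -> fn) : Prop :=
  forall Z, Sh Z -> Sh (A Z) /\ forall V, Sh V -> ip (A Z) V = B Z V.

End finite_element_space.

Section time.
Variable T : R.
Local Notation lam := (@lebesgue_measure R).
Implicit Types (u : R -> fn) (X : fn -> Prop).

Definition simple_path u : Prop :=
  exists (m : nat) (E : 'I_m -> set R) (c : 'I_m -> fn),
    (forall k, measurable (E k) /\ L2 (c k)) /\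
    forall t x, u t x = \sum_k \1_(E k) t * c k x.

Definition strongly_measurable u : Prop :=
  exists s : nat -> R -> fn, (forall n, simple_path (s n)) /\
    {ae lam, forall t, 0 <= t <= T ->
      L2norm (s n t \- u t) @[n --> \oo] --> (0 : R)}.

(* u belongs to L_r(0,T;X), resp. L_infty(0,T;X), where X is a subspace of
   L_2(Omega) equipped with the L_2 norm *)
Definition Lr_time (r : nat) X u : Prop :=
  [/\ forall t, 0 <= t <= T -> X (u t), strongly_measurable u &
   (\int[lam]_(t in `[0%R, T]) ((L2norm (u t)) ^+ r)%:E < +oo)%E].

Definition Linfty_time X u : Prop :=
  [/\ forall t, 0 <= t <= T -> X (u t), strongly_measurable u &
   exists C, {ae lam, forall t, 0 <= t <= T -> L2norm (u t) <= C}].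

Definition continuous_time_at u t : Prop :=
  L2norm (u s \- u t) @[s --> within `[0, T] (nbhs t)] --> (0 : R).

Definition continuous_time u : Prop :=
  forall t, 0 <= t <= T -> continuous_time_at u t.

Definition piecewise_continuous_time u : Prop :=
  exists D : seq R,
    (forall t, 0 <= t <= T -> t \notin D -> continuous_time_at u t) /\
    (forall t, 0 <= t <= T ->
      (0 < t -> exists2 l, L2 l & L2norm (u s \- l) @[s --> t^'-] --> (0 : R)) /\
      (t < T -> exists2 l, L2 l & L2norm (u s \- l) @[s --> t^'+] --> (0 : R))).

Definition Lipschitz_time X u : Prop :=
  (forall t, 0 <= t <= T -> X (u t)) /\
  exists C, forall s t, 0 <= s <= T -> 0 <= t <= T ->
    L2norm (u s \- u t) <= C * `|s - t|.

Definition continuous_H10 u : Prop :=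
  exists gu : R -> 'rV[R]_d -> 'rV[R]_d,
    (forall t, 0 <= t <= T -> H10grad (u t) (gu t)) /\
    forall t, 0 <= t <= T ->
      Num.sqrt (L2norm (u s \- u t) ^+ 2 + L2norm_vec (gu s \- gu t) ^+ 2)
        @[s --> within `[0, T] (nbhs t)] --> (0 : R).

Definition time_test_fun (phi : R -> R) : Prop :=
  (forall n t, derivable (derive1n n phi) t 1) /\
  exists K : set R, [/\ compact K, K `<=` `]0, T[ & forall t, ~ K t -> phi t = 0].

(* u' is the distributional time derivative of u on (0,T); the L_2(Omega)-valued
   identity is tested against every element of L_2(Omega). *)
Definition weak_dt u u' : Prop :=
  forall phi v, time_test_fun phi -> L2 v ->
    \int[lam]_(t in `[0, T]) (derive1 phi t * ip (u t) v) =
    - \int[lam]_(t in `[0, T]) (phi t * ip (u' t) v).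

Definition L2S_norm (N : R -> fn -> R) u : \bar R :=
  ((\int[lam]_(t in `[0%R, T]) ((N t (u t)) ^+ 2)%:E) `^ 2^-1)%E.

Definition L1L2_norm u : \bar R :=
  (\int[lam]_(t in `[0%R, T]) (L2norm (u t))%:E)%E.

End time.

Section coefficient.
Variables (T : R) (a : R -> 'rV[R]_d -> 'M[R]_d).
Local Notation Q := ([set tx | 0 < tx.1 < T /\ Omega tx.2]
  : set (measurableTypeR R * 'rV[R]_d)).

Definition spd (M : 'M[R]_d) : Prop :=
  M^T = M /\ forall zeta : 'rV[R]_d, zeta != 0 -> 0 < dotv (actv M zeta) zeta.

Definition is_sqrtmx (M s : 'M[R]_d) : Prop :=
  [/\ s^T = s, forall zeta : 'rV[R]_d, 0 <= dotv (actv s zeta) zeta &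
      s *m s = M].

Definition ae_space_time (P : R -> 'rV[R]_d -> Prop) : Prop :=
  {ae (@lebesgue_measure R \x leb R d)%E, forall tx, Q tx -> P tx.1 tx.2}.

Definition admissible_coef (Th : mesh Omega) : Prop :=
  [/\ (forall i j, measurable_fun Q (fun tx => a tx.1 tx.2 i j)) /\
        (exists C, ae_space_time (fun t x => forall i j, `|a t x i j| <= C)),
      ae_space_time (fun t x => spd (a t x)),
      exists al be : R, 0 < al /\
        ae_space_time (fun t x => forall zeta : 'rV[R]_d, zeta != 0 ->
          al <= dotv (actv (a t x) zeta) zeta / dotv zeta zeta <= be),
      forall k x, elt Th k x -> {within `[0, T], continuous (a ^~ x)} &
      forall k t, 0 <= t <= T -> forall x, elt Th k x ->
        {for x, continuous (a t)}].

(* The requirement is void on the null set where a is not positive definite. *)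
Definition sqrt_coef (sa : R -> 'rV[R]_d -> 'M[R]_d) : Prop :=
  (forall i j, measurable_fun Q (fun tx => sa tx.1 tx.2 i j)) /\
  forall t x, 0 <= t <= T -> Omega x -> spd (a t x) ->
    is_sqrtmx (a t x) (sa t x).

Definition consistent_on_H10 (sa : R -> 'rV[R]_d -> 'M[R]_d)
    (B : R -> fn -> fn -> R) (N : R -> fn -> R) : Prop :=
  forall t v z g h, 0 <= t <= T -> H10grad v g -> H10grad z h ->
    B t v z = aform (a t) g h /\
    N t v = L2norm_vec (fun x => actv (sa t x) (g x)).

Definition weak_solution (f : R -> fn) (u0 : fn) (u u' : R -> fn) : Prop :=
  [/\ continuous_H10 T u, Lr_time T 2 L2 u', weak_dt T u u',
      eq_on (u 0) u0 &
      {ae (@lebesgue_measure R), forall t, 0 <= t <= T ->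
        forall v gu gv, H10grad (u t) gu -> H10grad v gv ->
          ip (u' t) v + aform (a t) gu gv = ip (f t) v}].

End coefficient.

Section semidiscrete.
Variables (Th : mesh Omega) (p : nat) (T : R).
Variables (f : R -> fn) (B : R -> fn -> fn -> R).

(* The time derivative U' of a Lipschitz function is only determined almost
   everywhere, hence so is the scheme. *)
Definition semidiscrete_solution (U U' : R -> fn) : Prop :=
  [/\ Lipschitz_time T (Sh Th p) U, Linfty_time T (Sh Th p) U',
      weak_dt T U U' &
      {ae (@lebesgue_measure R), forall t, 0 <= t <= T ->
        forall V, Sh Th p V -> ip (U' t) V + B t (U t) V = ip (f t) V}].

Definition elliptic_reconstruction (Pi : fn -> fn) (A : R -> fn -> fn)
    (U w : R -> fn) : Prop :=
  forall t, 0 <= t <= T -> H10 (w t) /\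
    forall v, H10 v ->
      B t (w t) v = ip (fun x => A t (U t) x - Pi (f t) x + f t x) v.

(* The nonconforming part is assumed to be in W^{1,1}(0,T;S), so that its time
   derivative and the initial value Uc 0 make sense. *)
Definition conforming_decomposition (U Uc Ud Ud' : R -> fn) : Prop :=
  [/\ forall t, 0 <= t <= T -> [/\ Sh Th p (Uc t), H10 (Uc t), Sh Th p (Ud t) &
        eq_on (Ud t) (U t \- Uc t)],
      continuous_time T Ud, Lr_time T 1 (Sh Th p) Ud' & weak_dt T Ud Ud'].

End semidiscrete.
End spaces.

(* Main.v *)
Require Import Defs.
From mathcomp Require Import all_boot all_order all_algebra.
From mathcomp Require Import all_classical all_reals all_analysis.
From mathcomp Require Import measurable_realfun ring lra.
Set Implicit Arguments.
Unset Strict Implicit.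
Unset Printing Implicit Defensive.
Import Order.TTheory GRing.Theory Num.Theory.
Import numFieldNormedType.Exports.
Local Open Scope classical_set_scope.
Local Open Scope ring_scope.

(* Write e = u - U + Ud, which represents u - U_c.  By the scheme, A U - Pi f is
   the element - dt U of S, so that the error equation reads
   <dt u - dt U, v> + B(u - w, v) = 0 for v in H^1_0.  Testing it with e and using
   2 B(rho, rho + theta) >= |||rho|||^2 - |||theta|||^2 for rho = u - w and
   theta = w - U_c = (w - U) + U_d gives
     d/dt ||e||^2 + |||u - w|||^2 <= |||theta|||^2 + 2 ||dt U_d|| ||e||
   for almost every t.  Integrating up to a maximum point of ||e|| and up to T
   yields the same bound for max ||e||^2 and for the L_2(0,T) norm of
   |||u - w|||, and the rest is algebra.

   The measurability of t |-> |||u - w||| is not available; it is replaced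
   by the lower bound r = max(0, |||u - U||| - |||w - U|||).

   The chain rule d/dt ||e||^2 = 2 <e', e> for the weak derivative comes from the
   du Bois-Reymond lemma, tested with smooth approximations of indicators of
   intervals, and from comparing ||e(t)||^2 - ||e(s)||^2 = <e(t) - e(s), e(t) + e(s)>
   with 2 int_s^t <e', e> on short intervals. *)

(** The weak derivatives control scalar pairings only: for a fixed [v] the function <e(t), v> is the
    integral of an integrable function, and no vector-valued integral of [e'] is formed. This is why
    the chain rule goes through short intervals glued by [cousin_interval], with the vector
    [e s + e r] frozen on each of them. The pairings <e', e> and the norms of derivatives are known
    to be measurable only up to null sets; they are replaced by measurable representatives, and
    integrals must not see null sets.

    [e] is formed from [u], [U] and [Ud] because these paths come with a derivative, while [Uc] does
    not.

    Constants: completing the square in the bound for M = max ||e|| gives M <= 2 D + E + Theta,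
    where D is the L^1 norm of dt U_d, E = ||e(0)|| and Theta is the L_2(0,T) norm of |||w - U||| +
    |||U_d|||. The coefficient 2 of D in the result originates here. Returning from [r] to |||u -
    U||| costs one more |||w - U|||, which is the summand 1 in the first coefficient. *)

Section ae_integral.
Context d (X : measurableType d) (R : realType).
Variable mu : {measure set X -> \bar R}.
Implicit Types (D : set X).
Import HBNNSimple.

(** The integral of a nonnegative function is a supremum over the simple functions below it. Such a
    function below [f], set to zero on a measurable null set containing all points of [D] where [f]
    and [g] differ, lies below [g] and keeps its integral. *)
Local Lemma ge0_ae_le_integral_any D (f g : X -> \bar R) :
  (forall x, D x -> 0 <= f x)%E -> (forall x, D x -> 0 <= g x)%E ->
  ae_eq mu D f g -> (\int[mu]_(x in D) f x <= \int[mu]_(x in D) g x)%E.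
Proof.
move=> f0 g0 [M [mM M0 sM]].
rewrite ge0_integralE// [leRHS]ge0_integralE//.
apply: ge_ereal_sup => /= _ [h /= hf <-].
have mM' : measurable (~` M) by exact: measurableC.
pose h' : {nnsfun X >-> R} := proj_nnsfun h mM'.
have h'E x : h' x = ((h : X -> R) \_ (~` M)) x by rewrite (mrestrict h mM').
have -> : sintegral mu h = sintegral mu h'.
  have E1 : (\int[mu]_x (h x)%:E = sintegral mu h)%E.
    by rewrite integral_nnsfun// patch_setT.
  have E2 : (\int[mu]_x (h' x)%:E = sintegral mu h')%E.
    by rewrite integral_nnsfun// patch_setT.
  rewrite -E1 -E2; apply: ge0_ae_eq_integral => //.
  - by apply/measurable_EFinP; exact: measurable_funPT.
  - by apply/measurable_EFinP; exact: measurable_funPT.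
  - by move=> x _; rewrite lee_fin; exact: fun_ge0.
  - by move=> x _; rewrite lee_fin; exact: fun_ge0.
  exists M; split => // x /not_implyP[_ hx]; apply: contrapT => nM; apply: hx.
  by rewrite h'E patchE mem_set.
apply: ereal_sup_ubound; exists h' => // x.
rewrite h'E patchE; have [xM|xM] := boolP (x \in ~` M); last first.
  by rewrite patchE; case: ifPn => // /set_mem Dx; exact: g0.
apply: le_trans (hf x) _; rewrite !patchE.
case: ifPn => // /set_mem Dx.
suff -> : f x = g x by [].
apply: contrapT => fg; move/set_mem: xM; apply; apply: sM => /= fg'.
exact/fg/fg'.
Qed.

(* The integral is defined through simple functions from below, so that it is
   insensitive to null sets even for non-measurable integrands. *)
Lemma ae_eq_integral_any D (f g : X -> \bar R) :
  ae_eq mu D f g -> (\int[mu]_(x in D) f x = \int[mu]_(x in D) g x)%E.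
Proof.
have ge0 (h k : X -> \bar R) : (forall x, D x -> 0 <= h x)%E ->
    (forall x, D x -> 0 <= k x)%E -> ae_eq mu D h k ->
    (\int[mu]_(x in D) h x = \int[mu]_(x in D) k x)%E.
  move=> h0 k0 hk; apply/eqP; rewrite eq_le !ge0_ae_le_integral_any//.
  exact: ae_eq_sym.
move=> /ae_eq_funeposneg[fgp fgn]; rewrite integralE [RHS]integralE.
by congr (_ - _)%E; apply: ge0.
Qed.

Lemma ae_eq_Rintegral_any D (f g : X -> R) :
  ae_eq mu D f g -> \int[mu]_(x in D) f x = \int[mu]_(x in D) g x.
Proof.
move=> fg; rewrite /Rintegral; congr fine; apply: ae_eq_integral_any.
by apply: filterS fg => x fg /fg ->.
Qed.

Lemma ae_le_Rintegral D (f g : X -> R) : measurable D ->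
  mu.-integrable D (EFin \o f) -> mu.-integrable D (EFin \o g) ->
  {ae mu, forall x, D x -> f x <= g x} ->
  \int[mu]_(x in D) f x <= \int[mu]_(x in D) g x.
Proof.
move=> mD fi gi fg; rewrite -subr_ge0 -RintegralB//.
(* The difference is nonnegative only almost everywhere; its positive part is nonnegative everywhere
   and has the same integral. *)
rewrite (@ae_eq_Rintegral_any D _ (fun x => Num.max 0 (g x - f x))).
  by apply: Rintegral_ge0 => x _; rewrite le_max lexx.
apply: filterS fg => x fg Dx; rewrite max_r// subr_ge0; exact: fg.
Qed.

End ae_integral.

#[local] Instance ae_lebesgue_filter (R : realType) :
  Filter (nbhs (almost_everywhere (@lebesgue_measure R))).
Proof. exact: ae_filter_ringOfSetsType. Qed.

(** * Square-integrable functions *)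

Section square_integrable.
Context d (X : measurableType d) (R : realType).
Variables (mu : {measure set X -> \bar R}) (D : set X).
Hypothesis mD : measurable D.
Implicit Types v z : X -> R.

(** For [leb R d] on [Omega] the notions [sqi], [iprod] and [nrm] unfold to [L2], [ip] and [L2norm];
    for [lebesgue_measure] on [0, T] they serve the time norms of the final estimate. Functions
    equal almost everywhere are not identified, so [iprod] is only a semi-inner product. *)
Definition sqi v := measurable_fun D v /\
  (\int[mu]_(x in D) ((v x) ^+ 2)%:E < +oo)%E.
Definition iprod v z : R := \int[mu]_(x in D) (v x * z x).
Definition nrm v : R := Num.sqrt (iprod v v).

Lemma sqi_integrable v : sqi v -> mu.-integrable D (fun x => ((v x) ^+ 2)%:E).
Proof.
move=> [mv vi]; apply/integrableP; split.
  by apply/measurable_EFinP; exact: measurable_funX.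
apply: le_lt_trans vi; rewrite le_eqVlt; apply/orP; left; apply/eqP.
by apply: eq_integral => x _; rewrite gee0_abs// lee_fin sqr_ge0.
Qed.

Lemma integrable_sqi v : measurable_fun D v ->
  mu.-integrable D (fun x => ((v x) ^+ 2)%:E) -> sqi v.
Proof.
move=> mv /integrableP[_ vi]; split => //; apply: le_lt_trans vi.
rewrite le_eqVlt; apply/orP; left; apply/eqP.
by apply: eq_integral => x _; rewrite gee0_abs// lee_fin sqr_ge0.
Qed.

Lemma sqi_mul_integrable v z : sqi v -> sqi z ->
  mu.-integrable D (EFin \o (fun x => v x * z x)).
Proof.
move=> sv sz.
have := integrableD mD (sqi_integrable sv) (sqi_integrable sz).
apply: le_integrable => //.
  apply/measurable_EFinP; apply: measurable_funM; [exact: sv.1|exact: sz.1].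
move=> x Dx /=; rewrite !lee_fin ler_norml.
rewrite ger0_norm ?addr_ge0 ?sqr_ge0//.
apply/andP; split; have := sqr_ge0 (v x + z x); have := sqr_ge0 (v x - z x);
  have := sqr_ge0 (v x); have := sqr_ge0 (z x); nra.
Qed.

Lemma sqi0 : sqi (fun=> 0).
Proof.
split; first exact: measurable_cst.
by rewrite integral0_eq// => x _; rewrite expr0n.
Qed.

Lemma sqiD v z : sqi v -> sqi z -> sqi (v \+ z).
Proof.
move=> sv sz; have mvz : measurable_fun D (v \+ z).
  by apply: measurable_funD; [exact: sv.1|exact: sz.1].
apply: integrable_sqi => //.
have := integrableZl mD 2%R (integrableD mD (sqi_integrable sv) (sqi_integrable sz)).
apply: le_integrable => //.
  by apply/measurable_EFinP; exact: measurable_funX.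
move=> x Dx /=; rewrite lee_fin ger0_norm ?sqr_ge0//.
rewrite ger0_norm ?mulr_ge0 ?addr_ge0 ?sqr_ge0//.
by have := sqr_ge0 (v x - z x); nra.
Qed.

Lemma sqiZ c v : sqi v -> sqi (fun x => c * v x).
Proof.
move=> sv; have mv : measurable_fun D (fun x => c * v x).
  by apply: measurable_funM; [exact: measurable_cst|exact: sv.1].
apply: integrable_sqi => //.
have := integrableZl mD (c ^+ 2)%R (sqi_integrable sv).
by apply: eq_integrable => // x _; rewrite /= -EFinM exprMn.
Qed.

Lemma sqiB v z : sqi v -> sqi z -> sqi (v \- z).
Proof.
move=> sv sz; rewrite (_ : v \- z = v \+ (fun x => -1 * z x)).
  by apply: sqiD => //; exact: sqiZ.
by apply/funext => x /=; rewrite mulN1r.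
Qed.

Lemma iprodC v z : iprod v z = iprod z v.
Proof. by apply: eq_Rintegral => x _; rewrite mulrC. Qed.

Lemma iprodDl v v' z : sqi v -> sqi v' -> sqi z ->
  iprod (v \+ v') z = iprod v z + iprod v' z.
Proof.
move=> sv sv' sz; rewrite -RintegralD//; try exact: sqi_mul_integrable.
by apply: eq_Rintegral => x _ /=; rewrite mulrDl.
Qed.

Lemma iprodBl v v' z : sqi v -> sqi v' -> sqi z ->
  iprod (v \- v') z = iprod v z - iprod v' z.
Proof.
move=> sv sv' sz; rewrite -RintegralB//; try exact: sqi_mul_integrable.
by apply: eq_Rintegral => x _ /=; rewrite mulrBl.
Qed.

Lemma iprodZl c v z : sqi v -> sqi z ->
  iprod (fun x => c * v x) z = c * iprod v z.
Proof.
move=> sv sz; rewrite /iprod -RintegralZl//; last exact: sqi_mul_integrable.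
by apply: eq_Rintegral => x _ /=; rewrite mulrA.
Qed.

Lemma iprodDr v v' z : sqi v -> sqi v' -> sqi z ->
  iprod z (v \+ v') = iprod z v + iprod z v'.
Proof. by move=> *; rewrite iprodC iprodDl// !(iprodC z). Qed.

Lemma iprodBr v v' z : sqi v -> sqi v' -> sqi z ->
  iprod z (v \- v') = iprod z v - iprod z v'.
Proof. by move=> *; rewrite iprodC iprodBl// !(iprodC z). Qed.

Lemma iprodZr c v z : sqi v -> sqi z ->
  iprod z (fun x => c * v x) = c * iprod z v.
Proof. by move=> *; rewrite iprodC iprodZl// (iprodC z). Qed.

Lemma iprod_ge0 v : 0 <= iprod v v.
Proof. by apply: Rintegral_ge0 => x _; rewrite -expr2 sqr_ge0. Qed.

Lemma iprod_ae v v' z z' : ae_eq mu D v v' -> ae_eq mu D z z' ->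
  iprod v z = iprod v' z'.
Proof.
move=> vv zz; apply: ae_eq_Rintegral_any.
by apply: filterS2 vv zz => x vv zz Dx; rewrite vv// zz.
Qed.

Lemma nrm_ge0 v : 0 <= nrm v. Proof. exact: sqrtr_ge0. Qed.

Lemma sqr_nrm v : nrm v ^+ 2 = iprod v v.
Proof. by rewrite sqr_sqrtr// iprod_ge0. Qed.

Lemma nrm_ae v v' : ae_eq mu D v v' -> nrm v = nrm v'.
Proof. by move=> vv; rewrite /nrm (iprod_ae vv vv). Qed.

(** ||v + c z||^2 is nonnegative for every real c, in particular at the minimizer c = - <v, z> /
    ||z||^2. Since ||z|| = 0 may hold for a function [z] other than 0, that case is treated
    apart. *)
Lemma cauchy_schwarz v z : sqi v -> sqi z -> `|iprod v z| <= nrm v * nrm z.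
Proof.
move=> sv sz; rewrite -(@ler_pXn2r _ 2)// ?nnegrE ?mulr_ge0 ?nrm_ge0//.
rewrite exprMn !sqr_nrm real_normK ?num_real//.
have expand c : 0 <= iprod v v + 2 * c * iprod v z + c ^+ 2 * iprod z z.
  have scz := sqiZ c sz; have := iprod_ge0 (v \+ (fun x => c * z x)).
  rewrite iprodDl ?iprodDr//; last exact: sqiD.
  by rewrite !iprodZl ?iprodZr// (iprodC z v); nra.
have := expand (- iprod v z); have := iprod_ge0 v; have := iprod_ge0 z.
set a := iprod v v in expand *; set b := iprod v z in expand *.
set c := iprod z z in expand *; move=> c0 a0 _.
have [c_eq0|cN0] := eqVneq c 0.
  rewrite c_eq0 mulr0; have [->|bN0] := eqVneq b 0; first by rewrite expr0n.
  (* Without quadratic term, a nonzero slope is impossible: this choice would give the value -1. *)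
  have := expand (- (a + 1) / (2 * b)); rewrite c_eq0 mulr0 addr0.
  have -> : 2 * (- (a + 1) / (2 * b)) * b = - (a + 1) by field.
  lra.
have cp : 0 < c by rewrite lt_def cN0.
have := expand (- b / c).
have -> : a + 2 * (- b / c) * b + (- b / c) ^+ 2 * c = (a * c - b ^+ 2) / c by field.
by rewrite pmulr_lge0 ?invr_gt0// subr_ge0.
Qed.

Lemma nrmD v z : sqi v -> sqi z -> nrm (v \+ z) <= nrm v + nrm z.
Proof.
move=> sv sz; rewrite -(@ler_pXn2r _ 2)// ?nnegrE ?addr_ge0 ?nrm_ge0//.
rewrite sqr_nrm iprodDl ?iprodDr//; last exact: sqiD.
rewrite -!sqr_nrm (iprodC z v); have := cauchy_schwarz sv sz.
have := ler_norm (iprod v z); rewrite !sqr_nrm; have := sqr_nrm v.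
have := sqr_nrm z; nra.
Qed.

Lemma nrmZ c v : sqi v -> nrm (fun x => c * v x) = `|c| * nrm v.
Proof.
move=> sv; rewrite /nrm iprodZl ?iprodZr//; last exact: sqiZ.
by rewrite mulrA -expr2 sqrtrM ?sqr_ge0// sqrtr_sqr.
Qed.

Lemma nrmBC v z : nrm (v \- z) = nrm (z \- v).
Proof.
by congr Num.sqrt; apply: eq_Rintegral => x _ /=; rewrite -mulrNN !opprB.
Qed.

Lemma nrm_dist v z : sqi v -> sqi z -> `|nrm v - nrm z| <= nrm (v \- z).
Proof.
have tri a b : sqi a -> sqi b -> nrm a - nrm b <= nrm (a \- b).
  move=> sa sb; rewrite lerBlDr; apply: le_trans (nrmD (sqiB sa sb) sb).
  rewrite le_eqVlt; apply/orP; left; apply/eqP; congr nrm.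
  by apply/funext => x /=; rewrite subrK.
move=> sv sz; rewrite ler_norml lerNl opprB tri// andbT nrmBC.
exact: tri.
Qed.

End square_integrable.

(** * Borel sets and Lebesgue measure on row vectors *)

Section rV_borel.
Context {R : realType}.

(** The sigma-algebra is generated by the coordinates, not by the open sets; an open set is the
    union of the countably many rational boxes that it contains. *)
Lemma open_measurable_rV n (U : set 'rV[R]_n) : open U -> measurable U.
Proof.
move=> oU; pose box (q : 'rV[rat]_n * 'rV[rat]_n) : set 'rV[R]_n :=
  [set y | forall j, ratr (q.1 ord0 j) < y ord0 j < ratr (q.2 ord0 j)].
have mbox q : measurable (box q).
  rewrite (_ : box q = \bigcap_(j in [set: 'I_n])
      [set y | y ord0 j \in `]ratr (q.1 ord0 j), ratr (q.2 ord0 j)[]).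
    apply: fin_bigcap_measurable => // j _.
    have := @measurable_rV_coord R n j measurableT _
      (measurable_itv `]ratr (q.1 ord0 j), ratr (q.2 ord0 j)[).
    by rewrite setTI.
  apply/seteqP; split => [y yq j _|y yq j]; first by rewrite /= in_itv/= yq.
  by have := yq j I; rewrite /= in_itv.
rewrite (_ : U = \bigcup_(q in [set: _]) if `[< box q `<=` U >] then box q else set0).
  apply: countable_bigcupT_measurable => [|q]; first exact: countableP.
  by case: ifP.
apply/seteqP; split => [x Ux|x [q _]]; last first.
  by case: ifPn => // /asboolP; exact.
have [P Px PU] : nbhs x U by exact: open_nbhs_nbhs.
have /all_sig[q Hq] (j : 'I_n) : {q : rat * rat |
    ratr q.1 < x ord0 j < ratr q.2 /\
    forall y : R, ratr q.1 < y < ratr q.2 -> P ord0 j y}.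
  apply: cid; have [e /= e0 He] := Px ord0 j.
  have [] := @rat_in_itvoo R (x ord0 j - e) (x ord0 j); first by rewrite ltrBlDr ltrDl.
  move=> q /itvP qP.
  have [] := @rat_in_itvoo R (x ord0 j) (x ord0 j + e); first by rewrite ltrDl.
  move=> r /itvP rP; exists (q, r) => /=; split; first by rewrite qP rP.
  move=> y /andP[qy yr]; apply: He; rewrite /ball/= ltr_distlC.
  by rewrite (lt_trans _ qy) ?qP//= (lt_trans yr) ?rP.
pose qq : 'rV[rat]_n * 'rV[rat]_n := (\row_j (q j).1, \row_j (q j).2).
exists qq => //; rewrite ifT => [j|]; first by rewrite !mxE; exact: (Hq j).1.
apply/asboolP => y yq; apply: PU => i j; rewrite (ord1 i).
by apply: (Hq j).2; have := yq j; rewrite /= !mxE.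
Qed.

Lemma continuous_measurable_rV n (v : 'rV[R]_n -> R) (D : set 'rV[R]_n) :
  measurable D -> continuous v -> measurable_fun D v.
Proof.
move=> mD /continuousP cv; apply: (@measurable_funS _ _ _ _ setT) => //.
apply: (measurability _ (RGenOpens.measurableE R)).
move=> _ [_ [a [b ->] <-]]; rewrite setTI; apply: open_measurable_rV.
by apply: cv; exact: interval_open.
Qed.

(** Induction on the dimension: [leb] is an iterated product, and along [rV_cons] the box becomes
    [-M, M] times the box of one dimension less. Dimension 0 carries a Dirac mass. *)
Lemma leb_box_fin n (M : R) :
  measurable [set x : 'rV[R]_n | forall i, `|x ord0 i| <= M] /\
  (leb R n [set x : 'rV[R]_n | forall i, (`|x ord0 i| <= M)%R] < +oo)%E.
Proof.
elim: n => [|n [mB IHn]].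
  rewrite (_ : [set x | _] = setT); last first.
    by apply/seteqP; split => // x _ i; have := ltn_ord i.
  by split => //=; rewrite diracT ltry.
set B := [set x | _]; have -> : B = \bigcap_(j in [set: 'I_n.+1])
      [set y | y ord0 j \in `[-M, M]].
  apply/seteqP; split => [y yq j _|y yq j].
    by rewrite /= in_itv/= -ler_norml; exact: yq.
  by have := yq j I; rewrite /= in_itv/= -ler_norml.
split.
  apply: fin_bigcap_measurable => // j _.
  have := @measurable_rV_coord R n.+1 j measurableT _ (measurable_itv `[-M, M]).
  by rewrite setTI.
rewrite /= /lebS /pushforward.
rewrite (_ : _ @^-1` _ = `[-M, M]%classic `*`
    [set x : 'rV[R]_n | forall i, `|x ord0 i| <= M]).
  rewrite product_measure1E//; apply: lte_mul_pinfty => //.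
  have E : lebesgue_measure `[- M, M]%classic \is a fin_num.
    by rewrite lebesgue_measure_itv; case: ifP.
  exact: E.
apply/seteqP; split => [[a y] /= h|[a y] /= [aM yM] j _].
  split => [|i]; first by have := h ord0 I; rewrite /= rV_cons0.
  by have := h (lift ord0 i) I; rewrite /= rV_consS/= in_itv/= -ler_norml.
case: (unliftP ord0 j) => [i ->|->]; last by rewrite /= rV_cons0.
by rewrite /= rV_consS/= in_itv/= -ler_norml.
Qed.

Lemma leb_bounded_fin n (A : set 'rV[R]_n) : measurable A -> bounded_set A ->
  (leb R n A < +oo)%E.
Proof.
move=> mA [M [_ /(_ (M + 1))]]; rewrite ltrDl ltr01 => /(_ isT) AM.
have [mB Bfin] := leb_box_fin n (M + 1).
apply: le_lt_trans Bfin; apply: le_measure; rewrite ?inE// => x Ax i.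
apply: le_trans (AM x Ax).
have -> : `|x| = mx_norm x by []; rewrite mx_normrE.
exact: (le_bigmax _ (fun i : 'I_1 * 'I_n => `|x i.1 i.2|) (ord0, i)).
Qed.

End rV_borel.

(** * Test functions and the stability of [H10] under differences *)

Section test_functions.
Context {R : realType} (d : nat) (Omega : set 'rV[R]_d).
Hypothesis mO : measurable Omega.
Hypothesis finO : (leb R d Omega < +oo)%E.
Implicit Types v z : 'rV[R]_d -> R.
Local Notation mu := (leb R d).

Lemma L2_bounded v (C : R) : measurable_fun Omega v ->
  (forall x, `|v x| <= C) -> L2 Omega v.
Proof.
move=> mv vC; apply: integrable_sqi => //.
apply: measurable_bounded_integrable => //; first exact: measurable_funX.
exists (C ^+ 2); split; first exact: num_real.
move=> M CM x _ /=; rewrite normrX; apply: le_trans (ltW CM).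
by rewrite lerXn2r// ?nnegrE// (le_trans (normr_ge0 _) (vC x)).
Qed.

(** The extreme value theorem on [K] bounds [v], and bounded measurable functions are
    square-integrable because [Omega] has finite measure. *)
Lemma L2_continuous_compact v (K : set 'rV[R]_d) : compact K -> continuous v ->
  (forall x, ~ K x -> v x = 0) -> L2 Omega v.
Proof.
move=> cK cv v0.
have [C HC] : exists C, forall x, `|v x| <= C.
  have [K0|K0] := pselect (K !=set0); last first.
    by exists 0 => x; rewrite v0 ?normr0// => Kx; apply: K0; exists x.
  have cn : {within K, continuous (fun x => `|v x|)}.
    apply: continuous_subspaceT => x.
    exact: (continuous_comp (cv x) (@norm_continuous _ R _)).
  have [c _ Hc] := compact_EVT_max K0 cK cn; exists `|v c| => x.
  have [Kx|Kx] := pselect (K x); first by apply: Hc; rewrite inE.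
  by rewrite v0// normr0.
by apply: L2_bounded HC; exact: continuous_measurable_rV.
Qed.

Lemma CkB k v z : Ck k v -> Ck k z -> Ck k (v \- z).
Proof.
elim: k v z => [|k IHk] v z /=.
  by move=> cv cz x; exact: (cvgB (cv x) (cz x)).
move=> [dv pv] [dz pz]; split => [x|i]; first exact: differentiableB.
rewrite (_ : partial i (v \- z) = partial i v \- partial i z); first exact: IHk.
by apply/funext => x; rewrite /partial /= deriveB//; exact: diff_derivable.
Qed.

Lemma test_funB v z :
  test_fun Omega v -> test_fun Omega z -> test_fun Omega (v \- z).
Proof.
move=> [Cv [K [cK KO vK]]] [Cz [L [cL LO zL]]]; split; first by move=> k; exact: CkB.
exists (K `|` L); split; first exact: compactU.
  by move=> x [/KO|/LO].
by move=> x /= /not_orP[Kx Lx]; rewrite vK// zL// subrr.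
Qed.

Lemma test_fun_L2 v : test_fun Omega v -> L2 Omega v.
Proof.
by move=> [Cv [K [cK _ vK]]]; apply: L2_continuous_compact cK _ vK; exact: (Cv 0%N).
Qed.

Lemma test_fun_partial_L2 v i : test_fun Omega v -> L2 Omega (partial i v).
Proof.
move=> [Cv [K [cK _ vK]]]; apply: (L2_continuous_compact cK).
  exact: (Cv 1%N).2.
move=> x Kx; rewrite /partial (@near_eq_derive _ _ _ _ (cst 0)) ?derive_cst//.
have oK : open (~` K).
  by apply: closed_openC; apply: compact_closed => //; exact: norm_hausdorff.
have : nbhs x (~` K) by exact: open_nbhs_nbhs.
by apply: filterS => y; exact: vK.
Qed.

Lemma gradvB v z : test_fun Omega v -> test_fun Omega z ->
  gradv (v \- z) = gradv v \- gradv z.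
Proof.
move=> [Cv _] [Cz _]; apply/funext => x; apply/rowP => i; rewrite !mxE /partial.
have [dv _] := Cv 1%N; have [dz _] := Cz 1%N.
by rewrite deriveB//; exact: diff_derivable.
Qed.

Lemma L2vecB (g h : 'rV[R]_d -> 'rV[R]_d) :
  L2vec Omega g -> L2vec Omega h -> L2vec Omega (g \- h).
Proof.
move=> Lg Lh i; rewrite (_ : (fun x => _) =
  (fun x => g x ord0 i) \- (fun x => h x ord0 i)).
  exact: (sqiB mO (Lg i) (Lh i)).
by apply/funext => x; rewrite !mxE.
Qed.

Lemma L2norm_vecE (g : 'rV[R]_d -> 'rV[R]_d) : L2vec Omega g ->
  L2norm_vec Omega g ^+ 2 = \sum_i L2norm Omega (fun x => g x ord0 i) ^+ 2.
Proof.
move=> Lg; rewrite sqr_sqrtr; last first.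
  by apply: Rintegral_ge0 => x _; apply: sumr_ge0 => i _; rewrite -expr2 sqr_ge0.
have -> : \sum_i L2norm Omega (fun x => g x ord0 i) ^+ 2 =
    \sum_i \int[mu]_(x in Omega) (g x ord0 i * g x ord0 i).
  by apply: eq_bigr => i _; exact: sqr_nrm.
rewrite /dotv /Rintegral.
have sumE (s : seq 'I_d) :
    \int[mu]_(x in Omega) \sum_(i <- s) (g x ord0 i * g x ord0 i) =
    \sum_(i <- s) \int[mu]_(x in Omega) (g x ord0 i * g x ord0 i) /\
    mu.-integrable Omega (EFin \o
      (fun x => \sum_(i <- s) (g x ord0 i * g x ord0 i))).
  elim: s => [|i s [IHs IHi]].
    under eq_Rintegral do rewrite big_nil.
    rewrite big_nil; split.
      by rewrite /Rintegral integral0_eq.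
    rewrite (_ : _ \o _ = cst 0%E); first exact: integrable0.
    by apply/funext => x /=; rewrite big_nil.
  have Li := sqi_mul_integrable mO (Lg i) (Lg i).
  under eq_Rintegral do rewrite big_cons.
  rewrite big_cons RintegralD// IHs; split => //.
  rewrite (_ : _ \o _ = ((EFin \o (fun x => g x ord0 i * g x ord0 i)%R) \+
    (EFin \o (fun x => \sum_(i <- s) (g x ord0 i * g x ord0 i))%R))%E).
    exact: integrableD.
  by apply/funext => x /=; rewrite big_cons EFinD.
exact: (sumE _).1.
Qed.

(** The crude factor [d] comes from bounding the Euclidean norm by the sum of the components. It is
    harmless, since the lemma serves to show that a sequence of such norms tends to 0. *)
Lemma L2norm_vecB (g h : 'rV[R]_d -> 'rV[R]_d) :
  L2vec Omega g -> L2vec Omega h ->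
  L2norm_vec Omega (g \- h) <=
    d%:R * (L2norm_vec Omega g + L2norm_vec Omega h).
Proof.
have -> : d%:R * (L2norm_vec Omega g + L2norm_vec Omega h) =
    \sum_(i < d) (L2norm_vec Omega g + L2norm_vec Omega h).
  by rewrite sumr_const card_ord mulr_natl.
move=> Lg Lh; have Lgh := L2vecB Lg Lh.
have S0 : 0 <= \sum_(i < d) (L2norm_vec Omega g + L2norm_vec Omega h).
  by apply: sumr_ge0 => i _; rewrite addr_ge0 ?sqrtr_ge0.
have comp (k : 'rV[R]_d -> 'rV[R]_d) i : L2vec Omega k ->
    L2norm Omega (fun x => k x ord0 i) <= L2norm_vec Omega k.
  move=> Lk; rewrite -(@ler_pXn2r _ 2)// ?nnegrE ?sqrtr_ge0//.
  rewrite L2norm_vecE// (bigD1 i)//= lerDl; apply: sumr_ge0 => j _.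
  exact: sqr_ge0.
rewrite -(@ler_pXn2r _ 2)// ?nnegrE ?sqrtr_ge0// L2norm_vecE//.
have sq_sum (F : 'I_d -> R) : (forall i, 0 <= F i) ->
    \sum_i F i ^+ 2 <= (\sum_i F i) ^+ 2.
  move=> F0; rewrite [leRHS]expr2 mulr_suml; apply: ler_sum => i _.
  rewrite expr2 ler_wpM2l// (bigD1 i)//= lerDl; exact: sumr_ge0.
apply: le_trans (sq_sum _ _) _; first by move=> i; exact: sqrtr_ge0.
rewrite lerXn2r ?nnegrE//; first by apply: sumr_ge0 => i _; exact: sqrtr_ge0.
apply: ler_sum => i _.
rewrite (_ : (fun x => _) = (fun x => g x ord0 i) \+ (fun x => -1 * h x ord0 i)).
  apply: le_trans (nrmD mO (Lg i) (sqiZ mO (-1) (Lh i))) _.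
  apply: lerD; first exact: comp.
  have := nrmZ mO (-1) (Lh i); rewrite normrN normr1 mul1r => ->.
  exact: comp.
by apply/funext => x; rewrite !mxE /= mulN1r.
Qed.

Lemma H10_L2 v : H10 Omega v -> L2 Omega v.
Proof. by move=> [g []]. Qed.

(** The differences of the approximating test functions approximate the difference. This makes u -
    w, w - U_c and u - U_c admissible in the error equation. *)
Lemma H10gradB v z g h : H10grad Omega v g -> H10grad Omega z h ->
  H10grad Omega (v \- z) (g \- h).
Proof.
move=> [Lv Lg [phi [tphi cphi gphi]]] [Lz Lh [psi [tpsi cpsi gpsi]]].
have Lgrad u : test_fun Omega u -> L2vec Omega (gradv u).
  move=> tu i; rewrite (_ : (fun x => _) = partial i u).
    exact: test_fun_partial_L2.
  by apply/funext => x; rewrite mxE.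
split; [exact: sqiB|exact: L2vecB|].
exists (fun n => phi n \- psi n); split=> [n||]; first exact: test_funB.
- have S : (L2norm Omega (phi n \- v) + L2norm Omega (psi n \- z)) @[n --> \oo] --> (0 : R).
    by rewrite -[X in _ --> X]addr0; exact: cvgD.
  apply: (squeeze_cvgr _ (cvg_cst 0) S); apply: nearW => n.
  rewrite sqrtr_ge0/= (_ : _ \- _ = (phi n \- v) \+ (z \- psi n)); last first.
    by apply/funext => x /=; ring.
  apply: le_trans (nrmD _ _ _) _ => //.
  + by apply: sqiB => //; exact: test_fun_L2.
  + by apply: sqiB => //; exact: test_fun_L2.
  by rewrite lerD2l -/(nrm _ _ _) nrmBC.
- have S : (d%:R * (L2norm_vec Omega (gradv (phi n) \- g) +
      L2norm_vec Omega (gradv (psi n) \- h))) @[n --> \oo] --> (0 : R).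
    rewrite [X in _ --> X](_ : _ = d%:R * (0 + 0)); last by rewrite addr0 mulr0.
    by apply: cvgM; [exact: cvg_cst|exact: cvgD].
  apply: (squeeze_cvgr _ (cvg_cst 0) S); apply: nearW => n.
  rewrite sqrtr_ge0/= gradvB//.
  rewrite (_ : _ \- _ = (gradv (phi n) \- g) \- (gradv (psi n) \- h)).
    apply: L2norm_vecB.
      exact: (L2vecB (Lgrad _ (tphi n)) Lg).
    exact: (L2vecB (Lgrad _ (tpsi n)) Lh).
  apply/funext => x /=; apply/rowP => i; rewrite !mxE; ring.
Qed.

Lemma H10B v z : H10 Omega v -> H10 Omega z -> H10 Omega (v \- z).
Proof.
by move=> [g vg] [h zh]; exists (g \- h); exact: H10gradB.
Qed.

End test_functions.

(** * Smooth cut-off functions *)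

Section smooth.
Context {R : realType}.
Implicit Types f g : R -> R.

(** The recursion differentiates [f] first and then descends, so that the product and quotient rules
    combine with an induction on [n]; [smooth_derivable_derive1n] returns to the iterated
    derivatives of [time_test_fun]. *)
Fixpoint differentiable_upto n f : Prop :=
  if n is n'.+1 then
    (forall x, derivable f x 1) /\ differentiable_upto n' (derive1 f)
  else True.

Definition smooth f := forall n, differentiable_upto n f.

Lemma smooth_derivable_derive1n f : smooth f ->
  forall n x, derivable (derive1n n f) x 1.
Proof.
move=> + n; elim: n f => [f /(_ 1%N)[]//|n IHn f sf x].
by rewrite derive1Sn; apply: IHn => m; exact: (sf m.+1).2.
Qed.

Lemma smooth_derivable f x : smooth f -> derivable f x 1.
Proof. by move=> /(_ 1%N)[]. Qed.

Lemma smooth_derive1 f : smooth f -> smooth (derive1 f).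
Proof. by move=> sf n; exact: (sf n.+1).2. Qed.

Lemma smooth_continuous f : smooth f -> continuous f.
Proof.
by move=> sf x; apply/differentiable_continuous/derivable1_diffP/smooth_derivable.
Qed.

Lemma differentiable_uptoS n f :
  differentiable_upto n.+1 f -> differentiable_upto n f.
Proof. by elim: n f => [//|n IHn] f [df sf]; split => //; exact: IHn. Qed.

Lemma differentiable_upto_cst n (c : R) : differentiable_upto n (cst c).
Proof.
elim: n c => [//|n IHn] c; split => [x|]; first exact: derivable_cst.
rewrite (_ : derive1 (cst c) = cst 0) ?IHn//.
by apply/funext => x; rewrite derive1_cst.
Qed.

Lemma differentiable_uptoD n f g : differentiable_upto n f ->
  differentiable_upto n g -> differentiable_upto n (f \+ g).
Proof.
elim: n f g => [//|n IHn] f g [df sf] [dg sg]; split => [x|].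
  exact: derivableD.
rewrite (_ : derive1 (f \+ g) = (derive1 f) \+ (derive1 g)); first exact: IHn.
by apply/funext => x /=; rewrite !derive1E deriveD.
Qed.

Lemma differentiable_uptoM n f g : differentiable_upto n f ->
  differentiable_upto n g -> differentiable_upto n (f \* g).
Proof.
elim: n f g => [//|n IHn] f g sf sg.
have [df sf'] := sf; have [dg sg'] := sg; split => [x|].
  exact: derivableM.
rewrite (_ : derive1 (f \* g) = (f \* (derive1 g)) \+ (g \* (derive1 f))).
  by apply: differentiable_uptoD; apply: IHn => //; exact: differentiable_uptoS.
by apply/funext => x /=; rewrite !derive1E deriveM.
Qed.

(** With h = 1/f one has h' = - f' h^2, a product of functions with [n] derivatives, the factor h by
    the induction hypothesis. *)
Lemma differentiable_uptoV n f : (forall x, f x != 0) ->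
  differentiable_upto n f -> differentiable_upto n (fun x => (f x)^-1).
Proof.
move=> f0; elim: n => [//|n IHn] sf; have [df sf'] := sf; split => [x|].
  exact: derivableV.
set h := fun x => (f x)^-1.
rewrite (_ : (derive1 h) = (cst (-1) \* (derive1 f)) \* (h \* h)).
  apply: differentiable_uptoM.
    by apply: differentiable_uptoM => //; exact: differentiable_upto_cst.
  by apply: differentiable_uptoM; apply: IHn; exact: differentiable_uptoS.
apply/funext => x /=; rewrite !derive1E deriveV//= /h /GRing.scale/=.
by rewrite -exprVn; ring.
Qed.

Lemma derive1_comp_affine f (a b x : R) : derivable f (a * x + b) 1 ->
  is_derive x 1 (fun x => f (a * x + b)) (a * (derive1 f) (a * x + b)).
Proof.
move=> df; rewrite mulrC.
have dg : is_derive x (1 : R) (fun x => a * x + b) a.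
  by apply: is_derive_eq; rewrite /GRing.scale/= !(mulr0, mulr1, add0r, addr0).
apply: (@is_derive1_comp _ f (fun x => a * x + b) x _ a) => //.
by rewrite derive1E; exact: derivableP.
Qed.

Lemma differentiable_upto_affine n f (a b : R) : differentiable_upto n f ->
  differentiable_upto n (fun x => f (a * x + b)).
Proof.
elim: n f => [//|n IHn] f [df sf]; split => [x|].
  by apply: ex_derive; exact: derive1_comp_affine.
rewrite (_ : derive1 _ = cst a \* (fun x => (derive1 f) (a * x + b))).
  by apply: differentiable_uptoM; [exact: differentiable_upto_cst|exact: IHn].
by apply/funext => x; rewrite derive1E (@derive_val _ _ _ _ _ _ _ (derive1_comp_affine _)).
Qed.

(** The polynomial factor makes the family closed under differentiation; the classical flat function
    exp(-1/x) is the case p = 1. *)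
Definition flat (p : {poly R}) x := if 0 < x then p.[x^-1] * expR (- x^-1) else 0.

Lemma poly_bound (p : {poly R}) :
  exists C k, 0 <= C /\ forall y, 1 <= y -> `|p.[y]| <= C * y ^+ k.
Proof.
elim/poly_ind: p => [|p c [C [k [C0 IHp]]]].
  by exists 0, 0%N; split => // y y1; rewrite horner0 normr0 mul0r.
exists (C + `|c|), k.+1; split => [|y y1]; first by rewrite addr_ge0.
rewrite hornerMXaddC mulrDl; apply: le_trans (ler_normD _ _) _; apply: lerD.
  rewrite normrM (ger0_norm (le_trans ler01 y1)) exprSr mulrA ler_wpM2r ?IHp//.
  exact: le_trans y1.
by rewrite ler_peMr// exprn_ege1.
Qed.

(** With y = 1/x, |p(y)| <= C y^k and exp y >= y^(k+1) / (k+1)!; taking the exponent k+1 instead of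
    k leaves a factor 1/y = x, which is what gives the limit 0 at the origin. *)
Lemma flat_bound (p : {poly R}) :
  exists C, 0 <= C /\ forall x, `|x| <= 1 -> `|flat p x| <= C * `|x|.
Proof.
have [C [k [C0 Ck]]] := poly_bound p.
exists (C * k.+1`!%:R); split => [|x x1]; first by rewrite mulr_ge0.
rewrite /flat; case: ifPn => [x0|_]; last by rewrite normr0 !mulr_ge0.
have y1 : 1 <= x^-1.
  by rewrite invr_ge1 ?unitfE ?gt_eqF//; move: x1; rewrite gtr0_norm.
rewrite normrM (gtr0_norm x0) (gtr0_norm (expR_gt0 _)) expRN.
rewrite ler_pdivrMr ?expR_gt0//; apply: le_trans (Ck _ y1) _.
have := expR_ge1Dxn k (ltW (lt_le_trans ltr01 y1)); set y := x^-1 in y1 *.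
have xE : x = y^-1 by rewrite invrK.
have y0 : 0 < y by exact: lt_le_trans y1.
move=> h; have {}h : y ^+ k.+1 <= k.+1`!%:R * expR y.
  rewrite mulrC -ler_pdivrMr ?ltr0n ?fact_gt0//; apply: le_trans h.
  by rewrite lerDr.
rewrite xE (_ : y ^+ k = y ^+ k.+1 * y^-1); last first.
  by rewrite exprSr mulfK// gt_eqF.
rewrite [leRHS](_ : _ = C * (k.+1`!%:R * expR y * y^-1)); last by ring.
by rewrite ler_wpM2l// ler_wpM2r// invr_ge0 ltW.
Qed.

Lemma flat_is_derive (p : {poly R}) (x : R) :
  is_derive x (1 : R) (flat p) (flat ('X ^+ 2 * (p - p^`())) x).
Proof.
have [x0|x0|->] := ltgtP x 0.
- rewrite {2}/flat ltNge (ltW x0)/=.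
  apply: (@near_eq_is_derive _ _ _ (cst 0)).
    near=> y; rewrite /flat ifF//; apply/negbTE; rewrite -leNgt.
    by apply: ltW; near: y; exact: lt_nbhsl.
- rewrite {2}/flat x0.
  have x1 : x != 0 by rewrite gt_eqF.
  have dV : is_derive x 1 (fun y : R => y^-1) (- x ^- 2).
    have := @is_deriveV R id x 1 1 x1 (is_derive_id _ _).
    by rewrite /GRing.scale/= mulr1.
  have d1 := @is_derive1_comp R (horner p) (fun y => y^-1) x _ _
    (is_derive_poly p x^-1) dV.
  have dN : is_derive x 1 (fun y : R => - y^-1) (x ^- 2).
    by rewrite -[x ^- 2]opprK; exact: is_deriveN.
  have d2 := @is_derive1_comp R expR (fun y => - y^-1) x _ _
    (is_derive_expR _) dN.
  have d3 : is_derive x 1 (fun y => p.[y^-1] * expR (- y^-1))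
      (('X^2 * (p - p^`())).[x^-1] * expR (- x^-1)).
    apply: (is_derive_eq (is_deriveM d1 d2)).
    by rewrite /GRing.scale/= !hornerE /=; field.
  apply: near_eq_is_derive d3.
  near=> y; rewrite /flat ifT//; near: y; exact: lt_nbhsr.
- rewrite {2}/flat ltxx.
  (* At 0 the difference quotient of [flat p] is again a flat function, that of X p, so the bound
     shows that it tends to 0. *)
  have [C [C0 HC]] := flat_bound ('X * p).
  have E h : h^-1 *: (flat p (h *: 1 + 0) - flat p 0) = flat ('X * p) h.
    rewrite addr0 {2}/flat ltxx subr0 /flat /GRing.scale/= mulr1.
    by case: ifP => h0; rewrite ?mulr0// hornerM hornerX mulrA.
  have cvg : flat ('X * p) h @[h --> 0] --> (0 : R).
    have near0 r : 0 < r -> \forall h \near (0 : R), `|h| < r.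
      by move=> r0; exists r => //= z /=; rewrite sub0r normrN.
    apply/cvgr0Pnorm_lt => e e0; near=> h.
    apply: le_lt_trans (HC h _) _; first by apply: ltW; near: h; exact: near0.
    have : `|h| < e / (C + 1).
      by near: h; apply: near0; rewrite divr_gt0// ltr_wpDl.
    by rewrite ltr_pdivlMr ?ltr_wpDl// => hh; have := normr_ge0 h; nra.
  have cvg' : h^-1 *: (flat p (h *: 1 + 0) - flat p 0) @[h --> 0^'] --> (0 : R).
    by under eq_fun do rewrite E; exact: cvg_within_filter.
  apply: DeriveDef; first by apply/cvg_ex; exists 0.
  exact: cvg_lim.
Unshelve. all: by end_near. Qed.

Lemma smooth_flat p : smooth (flat p).
Proof.
move=> n; elim: n p => [//|n IHn] p; split => [x|].
  by apply: ex_derive; exact: flat_is_derive.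
rewrite (_ : derive1 _ = flat ('X ^+ 2 * (p - p^`()))) ?IHn//.
apply/funext => x; rewrite derive1E.
by rewrite (@derive_val _ _ _ _ _ _ _ (flat_is_derive _ _)).
Qed.
End smooth.

Section smooth_step.
Context {R : realType}.

(** The standard smooth transition from 0 on x <= 0 to 1 on x >= 1; the two terms of the denominator
    never vanish together. *)
Definition step (x : R) := flat 1 x / (flat 1 x + flat 1 (1 - x)).

Let flat1E (x : R) : flat 1 x = if 0 < x then expR (- x^-1) else 0.
Proof. by rewrite /flat hornerC mul1r. Qed.

Let flat1_ge0 (x : R) : 0 <= flat 1 x.
Proof. by rewrite flat1E; case: ifP => // _; exact: expR_ge0. Qed.

Let flat1_gt0 (x : R) : 0 < x -> 0 < flat 1 x.
Proof. by rewrite flat1E => ->; exact: expR_gt0. Qed.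

Let denom_gt0 (x : R) : 0 < flat 1 x + flat 1 (1 - x).
Proof.
have [x0|x0] := ltP 0 x; first by rewrite ltr_pwDl// flat1_gt0.
by rewrite ltr_wpDl// flat1_gt0// subr_gt0 (le_lt_trans x0).
Qed.

Lemma smooth_step : smooth step.
Proof.
move=> n; apply: differentiable_uptoM; first exact: smooth_flat.
apply: differentiable_uptoV => [x|]; first by rewrite gt_eqF.
apply: differentiable_uptoD; first exact: smooth_flat.
rewrite (_ : (fun x => _) = (fun x => flat 1 ((-1) * x + 1))).
  by apply: differentiable_upto_affine; exact: smooth_flat.
by apply/funext => x; rewrite mulN1r addrC.
Qed.

Lemma step_ge0 x : 0 <= step x.
Proof. by rewrite divr_ge0// ltW. Qed.

Lemma step_le1 x : step x <= 1.
Proof. by rewrite ler_pdivrMr// mul1r lerDl. Qed.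

Lemma step_eq0 x : x <= 0 -> step x = 0.
Proof. by move=> x0; rewrite /step flat1E ltNge x0 mul0r. Qed.

Lemma step_eq1 x : 1 <= x -> step x = 1.
Proof.
move=> x1; rewrite /step [flat _ (1 - x)]flat1E subr_gt0 ltNge x1 addr0 divff//.
by rewrite gt_eqF// flat1_gt0// (lt_le_trans ltr01).
Qed.

(** Smooth approximation of the indicator of ]s, +oo[, with its transition on [s, s + 1/(n+1)]. *)
Definition ramp (n : nat) (s x : R) := step (n.+1%:R * x + - (n.+1%:R * s)).

Lemma smooth_ramp n s : smooth (ramp n s).
Proof. by move=> k; apply: differentiable_upto_affine; exact: smooth_step. Qed.

Lemma ramp_eq0 n s x : x <= s -> ramp n s x = 0.
Proof. by move=> xs; rewrite /ramp -mulrBr step_eq0// pmulr_rle0// subr_le0. Qed.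

Lemma ramp_eq1 n s x : s + n.+1%:R^-1 <= x -> ramp n s x = 1.
Proof.
move=> xs; rewrite /ramp -mulrBr step_eq1//.
by rewrite -[leLHS](@divff _ n.+1%:R)// ler_pM2l// lerBrDl.
Qed.

Lemma ramp_norm_le1 n s x : `|ramp n s x| <= 1.
Proof. by rewrite ger0_norm ?step_ge0 ?step_le1. Qed.

Lemma derive1_ramp n s x :
  derive1 (ramp n s) x = n.+1%:R * derive1 step (n.+1%:R * x + - (n.+1%:R * s)).
Proof.
have d := @derive1_comp_affine R step n.+1%:R (- (n.+1%:R * s)) x
  (smooth_derivable smooth_step).
by rewrite derive1E (@derive_val _ _ _ _ _ _ _ d).
Qed.

Lemma derive1_step_bound : exists C : R, 0 <= C /\ forall x, 0 <= x <= 1 ->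
  `|derive1 step x| <= C.
Proof.
have cf : {within `[0, 1], continuous (fun x => `|derive1 step x|)}.
  apply: continuous_subspaceT => x; apply: cvg_norm.
  exact/smooth_continuous/smooth_derive1/smooth_step.
have [c _ Hc] := @EVT_max R _ 0 1 ler01 cf.
exists `|derive1 step c|; split => // x x01; apply: Hc; by rewrite in_itv.
Qed.

Lemma derive1_near_cst (f : R -> R) (c x : R) :
  (\forall y \near x, f y = c) -> derive1 f x = 0.
Proof.
move=> fc; rewrite derive1E (@near_eq_derive _ _ _ _ (cst c)) ?derive_cst//.
Qed.

(** Rescaling produces the factor n+1, and outside the transition interval the ramp is locally
    constant. The bound has integral C whatever n is, so the derivatives can act as an approximate
    Dirac mass at [s]. *)
Lemma derive1_ramp_bound : exists C : R, 0 <= C /\ forall n s x,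
  `|derive1 (ramp n s) x| <= C * n.+1%:R * \1_(`[s, s + n.+1%:R^-1]) x.
Proof.
have [C [C0 HC]] := derive1_step_bound; exists C; split => // n s x.
rewrite indicE; have [|] := boolP (x \in `[s, s + n.+1%:R^-1]%classic).
  move/set_mem => /=; rewrite in_itv/= => /andP[sx xs].
  rewrite derive1_ramp normrM ger0_norm// mulr1 mulrC ler_wpM2r//.
  apply: HC; rewrite -mulrBr mulr_ge0 ?subr_ge0//=.
  by rewrite -[leRHS](@divff _ n.+1%:R)// ler_pM2l// lerBlDl.
rewrite notin_setE/= in_itv/= => /negP; rewrite negb_and -!ltNge mulr0.
move=> /orP[xs|xs].
  rewrite (@derive1_near_cst _ 0) ?normr0//; near=> y; apply: ramp_eq0.
  by apply: ltW; near: y; exact: lt_nbhsl.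
rewrite (@derive1_near_cst _ 1) ?normr0//; near=> y; apply: ramp_eq1.
by apply: ltW; near: y; exact: lt_nbhsr.
Unshelve. all: by end_near. Qed.

End smooth_step.

(** * The du Bois-Reymond lemma and the chain rule *)

Section du_bois_reymond.
Context {R : realType}.
Local Notation lam := (@lebesgue_measure R).
Variable T : R.
Hypothesis T0 : 0 < T.
Implicit Types F G : R -> R.

Let integrable_ramp_mul n s G : lam.-integrable `[0, T] (EFin \o G) ->
  lam.-integrable `[0, T] (EFin \o (fun x => ramp n s x * G x)).
Proof.
move=> iG; apply: le_integrable (iG) => //.
  apply/measurable_EFinP; apply: measurable_funM; last first.
    by apply/measurable_EFinP; exact: measurable_int iG.
  apply: (measurable_funS measurableT) => //.
  exact: (continuous_measurable_fun (smooth_continuous (@smooth_ramp R n s))).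
move=> x _ /=; rewrite lee_fin normrM -[leRHS]mul1r ler_wpM2r//.
exact: ramp_norm_le1.
Qed.

Let integrable_derive_ramp_mul n s F : {within `[0, T], continuous F} ->
  lam.-integrable `[0, T] (EFin \o (fun x => derive1 (ramp n s) x * F x)).
Proof.
move=> cF; apply: continuous_compact_integrable; first exact: segment_compact.
move=> x; apply: cvgM; last exact: cF.
apply: continuous_subspaceT => {}x.
exact: (smooth_continuous (smooth_derive1 (@smooth_ramp R n s))).
Qed.

(** Dominated convergence with majorant |G|: the ramps converge to the indicator of ]s, T] at every
    point of [0, T], including [s], where they all vanish. *)
Lemma cvg_ramp_integral (s : R) G : lam.-integrable `[0, T] (EFin \o G) ->
  0 < s < T ->
  \int[lam]_(x in `[0, T]) (ramp n s x * G x) @[n --> \oo] -->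
    \int[lam]_(x in `]s, T]) G x.
Proof.
move=> iG /andP[s0 sT].
have -> : \int[lam]_(x in `]s, T]) G x =
    \int[lam]_(x in `[0, T]) ((G \_ `]s, T]) x).
  rewrite -Rintegral_mkcondr; congr Rintegral; apply/seteqP; split => x /=.
    by rewrite !in_itv/= => /andP[sx xT]; rewrite xT sx (ltW (lt_trans s0 sx)).
  by case.
have [] := @dominated_convergence _ _ R lam `[0, T] (measurable_itv _)
  (fun n x => (ramp n s x * G x)%:E) (fun x => ((G \_ `]s, T]) x)%:E)
  (fun x => `|(G x)%:E|%E).
- by move=> n; exact: measurable_int (integrable_ramp_mul n s iG).
- apply/measurable_EFinP; apply/measurable_restrict => //.
  apply: measurable_funS (measurable_itv `[0, T]) _ _ => //.
  by apply/measurable_EFinP; exact: measurable_int iG.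
- apply: aeW => x /=; rewrite in_itv/= => /andP[x0 xT].
  apply: cvg_EFin; first exact: nearW.
  rewrite patchE; have [xs|xs] := leP x s.
    rewrite ifF; last first.
      by apply/negbTE; rewrite notin_setE/= in_itv/= ltNge xs.
    by under eq_fun do rewrite /= ramp_eq0// mul0r; exact: cvg_cst.
  rewrite mem_set/=; last by rewrite in_itv/= xs.
  apply: cvg_near_cst; near=> n; rewrite /= ramp_eq1 ?mul1r// -lerBrDl.
  apply: ltW; near: n; apply: near_infty_natSinv_lt (PosNum _).
  by rewrite subr_gt0.
- by have := integrable_abse iG.
- apply: aeW => x n _ /=; rewrite lee_fin normrM -[leRHS]mul1r ler_wpM2r//.
  exact: ramp_norm_le1.
move=> ig _ cv.
have cv' : (\int[lam]_(x in `[0%R, T]) (ramp n s x * G x)%:E)%E @[n --> \oo] -->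
    (\int[lam]_(x in `[0, T]) ((G \_ `]s, T]) x))%:E.
  by rewrite /Rintegral fineK//; apply: integrable_fin_num.
exact: (fine_cvg cv').
Unshelve. all: by end_near. Qed.

Lemma cvg_derive_ramp_integral (s : R) F : {within `[0, T], continuous F} ->
  0 < s < T ->
  \int[lam]_(x in `[0, T]) (derive1 (ramp n s) x * F x) @[n --> \oo] --> F s.
Proof.
move=> cF /andP[s0 sT]; have [C [C0 HC]] := @derive1_ramp_bound R.
have cFs : F x @[x --> s] --> F s.
  have /(continuous_within_itvP _ T0)[cF' _ _] := cF.
  by apply: cF'; rewrite in_itv/= s0.
have iD n : s + n.+1%:R^-1 <= T ->
    \int[lam]_(x in `[0, T]) (derive1 (ramp n s) x) = 1.
  move=> snT; rewrite /Rintegral (@continuous_FTC2 R _ (ramp n s))//.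
  - by rewrite ramp_eq1// (@ramp_eq0 _ n s 0) ?(ltW s0)//= subr0.
  - apply: continuous_subspaceT.
    exact: (smooth_continuous (smooth_derive1 (@smooth_ramp R n s))).
  - split=> [x _||]; first exact: (smooth_derivable (@smooth_ramp R n s)).
      exact/cvg_at_right_filter/(smooth_continuous (@smooth_ramp R n s)).
    exact/cvg_at_left_filter/(smooth_continuous (@smooth_ramp R n s)).
apply/cvgrPdist_le => e e0.
(* The derivative is at most C (n+1) on an interval of length 1/(n+1), so this tolerance leaves an
   error e C / (C + 1) <= e; C + 1 avoids dividing by 0. *)
have [dl /= dl0 Hdl] : \forall x \near s, `|F s - F x| <= e / (C + 1).
  by move/cvgrPdist_le : cFs; apply; rewrite divr_gt0// ltr_wpDl.
near=> n.
have nT : n.+1%:R^-1 < T - s.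
  by near: n; apply: near_infty_natSinv_lt (PosNum _); rewrite subr_gt0.
have ndl : n.+1%:R^-1 < dl by near: n; exact: near_infty_natSinv_lt (PosNum dl0).
have snT : s + n.+1%:R^-1 <= T by rewrite -lerBrDl ltW.
have iDF := integrable_derive_ramp_mul n s cF.
have iDc : lam.-integrable `[0, T] (EFin \o (fun x => derive1 (ramp n s) x * F s)).
  apply: integrable_derive_ramp_mul.
  by apply: continuous_subspaceT => x; exact: cvg_cst.
have iD1 : lam.-integrable `[0, T] (EFin \o (fun x => derive1 (ramp n s) x)).
  apply: continuous_compact_integrable; first exact: segment_compact.
  apply: continuous_subspaceT.
  exact: (smooth_continuous (smooth_derive1 (@smooth_ramp R n s))).
(* The derivative has integral 1 once the transition fits in [0, T], so the constant F s can be
   averaged with the same weight. *)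
have -> : F s = \int[lam]_(x in `[0, T]) (derive1 (ramp n s) x * F s).
  under eq_Rintegral do rewrite mulrC.
  by rewrite RintegralZl// iD// mulr1.
rewrite -RintegralB//.
have iB : lam.-integrable `[0, T] (EFin \o
    (fun x => derive1 (ramp n s) x * F s - derive1 (ramp n s) x * F x)).
  by have := integrableB _ iDc iDF; apply.
apply: le_trans (le_normr_Rintegral _ _) _ => //.
pose k := C * n.+1%:R * (e / (C + 1)).
have C1 : 0 < C + 1 by rewrite ltr_wpDl.
have k0 : 0 <= k.
  by apply: mulr_ge0; [exact: mulr_ge0|apply: divr_ge0; exact: ltW].
have mI : measurable (`[s, s + n.+1%:R^-1]%classic : set R) by exact: measurable_itv.
have iI : lam.-integrable `[0, T] (EFin \o (\1_(`[s, s + n.+1%:R^-1]) : R -> R)).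
  by apply: integrableS (integrable_indic_itv _ _ _ _) => //.
apply: (@le_trans _ _ (\int[lam]_(x in `[0, T]) (k * \1_(`[s, s + n.+1%:R^-1]) x))).
  apply: le_Rintegral => //.
  - exact: integrable_norm.
  - by have := integrableZl _ k iI; apply.
  move=> x _ /=; rewrite -mulrBr normrM.
  have := HC n s x; rewrite indicE.
  have [/set_mem/=|_] := boolP (x \in _).
    rewrite in_itv/= => /andP[sx xs]; rewrite !mulr1 => h.
    apply: ler_pM => //; apply: Hdl; rewrite /= distrC ger0_norm ?subr_ge0//.
    by apply: le_lt_trans ndl; rewrite lerBlDl.
  by rewrite !mulr0 normr_le0 => /eqP ->; rewrite normr0 mul0r.
rewrite RintegralZl// {1}/Rintegral integral_indic//.
rewrite setIidl; last first.
  move=> x /=; rewrite !in_itv/= => /andP[sx xs].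
  by rewrite (le_trans (ltW s0))//= (le_trans xs).
rewrite (_ : fine _ = n.+1%:R^-1); last first.
  have E : lam `[s, s + n.+1%:R^-1]%classic = (n.+1%:R^-1)%:E.
    rewrite lebesgue_measure_itv/= lte_fin ltrDl invr_gt0 ltr0n/=.
    by rewrite -EFinB addrAC subrr add0r.
  exact: (congr1 fine E).
rewrite (_ : k * _ = e * (C / (C + 1))).
  by rewrite ger_pMr// ler_pdivrMr// mul1r lerDl.
by rewrite /k; field; rewrite gt_eqF//= nat1r pnatr_eq0.
Unshelve. all: by end_near. Qed.

(** The difference of the ramps at s and t tends to the indicator of ]s, t], and its derivative to
    the difference of the Dirac masses at s and t. In the limit, [F] minus the primitive of [G]
    takes the same value at s and t. *)
Lemma du_bois_reymond F G : {within `[0, T], continuous F} ->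
  lam.-integrable `[0, T] (EFin \o G) ->
  (forall phi, time_test_fun T phi ->
    \int[lam]_(t in `[0, T]) (derive1 phi t * F t) =
    - \int[lam]_(t in `[0, T]) (phi t * G t)) ->
  forall t, 0 <= t <= T -> F t = F 0 + \int[lam]_(x in `[0, t]) G x.
Proof.
move=> cF iG FG.
pose P t := parameterized_integral lam 0 t G.
have cP : {within `[0, T], continuous P}.
  exact: (parameterized_integral_continuous (ltW T0) iG).
have Pcst (s t : R) : 0 < s < T -> 0 < t < T -> s < t -> F s - P s = F t - P t.
  move=> s0T t0T st; have /andP[s0 sT] := s0T; have /andP[t0 tT] := t0T.
  pose phi n := ramp n s \- ramp n t.
  (* The support lies in [s, t + 1/(n+1)], which is inside ]0, T[ only for large n. *)
  have test : \forall n \near \oo, time_test_fun T (phi n).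
    near=> n; split=> [k x|].
      apply: smooth_derivable_derive1n => m; apply: differentiable_uptoD.
        exact: smooth_ramp.
      rewrite (_ : (fun x => _) = cst (-1) \* ramp n t).
        apply: differentiable_uptoM; first exact: differentiable_upto_cst.
        exact: smooth_ramp.
      by apply/funext => y /=; rewrite mulN1r.
    exists `[s, t + n.+1%:R^-1]%classic; split.
    - exact: segment_compact.
    - move=> x /=; rewrite !in_itv/= => /andP[sx xt].
      rewrite (lt_le_trans s0 sx) (le_lt_trans xt)// -ltrBrDl.
      by near: n; apply: near_infty_natSinv_lt (PosNum _); rewrite subr_gt0.
    move=> x /=; rewrite in_itv/= => /negP; rewrite negb_and -!ltNge /phi.
    move=> /orP[xs|tx].
      by rewrite /= !ramp_eq0 ?subrr ?ltW// (lt_trans xs).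
    rewrite /= !ramp_eq1 ?subrr ?ltW//; apply: lt_trans tx.
    by rewrite ltrD2r.
  have dphi n x : derive1 (phi n) x = derive1 (ramp n s) x - derive1 (ramp n t) x.
    rewrite !derive1E deriveB//.
      exact: (smooth_derivable (@smooth_ramp R n s)).
    exact: (smooth_derivable (@smooth_ramp R n t)).
  have lhs : \int[lam]_(x in `[0, T]) (derive1 (phi n) x * F x) @[n --> \oo]
      --> F s - F t.
    have E n : \int[lam]_(x in `[0, T]) (derive1 (phi n) x * F x) =
        \int[lam]_(x in `[0, T]) (derive1 (ramp n s) x * F x) -
        \int[lam]_(x in `[0, T]) (derive1 (ramp n t) x * F x).
      rewrite -RintegralB//; try exact: integrable_derive_ramp_mul.
      by apply: eq_Rintegral => x _; rewrite dphi mulrBl.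
    under eq_fun do rewrite E.
    by apply: cvgB; exact: cvg_derive_ramp_integral.
  have rhs : (- \int[lam]_(x in `[0, T]) (phi n x * G x))%R @[n --> \oo]
      --> - (\int[lam]_(x in `]s, T]) G x - \int[lam]_(x in `]t, T]) G x).
    have E n : \int[lam]_(x in `[0, T]) (phi n x * G x) =
        \int[lam]_(x in `[0, T]) (ramp n s x * G x) -
        \int[lam]_(x in `[0, T]) (ramp n t x * G x).
      rewrite -RintegralB//; try exact: integrable_ramp_mul.
      by apply: eq_Rintegral => x _; rewrite mulrBl.
    under eq_fun do rewrite E.
    by apply: cvgN; apply: cvgB; exact: cvg_ramp_integral.
  have lim_eq : F s - F t =
      - (\int[lam]_(x in `]s, T]) G x - \int[lam]_(x in `]t, T]) G x).
    apply: (cvg_unique (@norm_hausdorff _ _) lhs); apply: cvg_trans rhs; apply: near_eq_cvg.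
    by near=> n; rewrite /= FG//; near: n.
  have PT r : 0 < r < T -> \int[lam]_(x in `]r, T]) G x = P T - P r.
    move=> /andP[r0 rT]; rewrite /P /parameterized_integral Rintegral_itvB//.
      by rewrite bnd_simp ltW.
    by rewrite bnd_simp ltW.
  move: lim_eq; rewrite (PT s)// (PT t)// => /(canRL (subrK _)) ->.
  by ring.
(* Test functions vanish near 0 and T, so constancy is known in the interior only. The midpoint
   serves as reference, and the endpoints are reached by one-sided limits. *)
have T2 : 0 < T / 2 < T.
  by rewrite divr_gt0//= ltr_pdivrMr// ltr_pMr// ltr1n.
have FP2 t : 0 < t < T -> F t - P t = F (T / 2) - P (T / 2).
  move=> t0T; have [tT|tT|->//] := ltgtP t (T / 2); first exact: Pcst.
  exact/esym/Pcst.
have [cF0 cFl cFr] := (continuous_within_itvP _ T0).1 cF.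
have [cP0 cPl cPr] := (continuous_within_itvP _ T0).1 cP.
have FP0 : F 0 - P 0 = F (T / 2) - P (T / 2).
  apply: (@cvg_unique _ (@norm_hausdorff _ _) ((F x - P x) @[x --> 0^'+])) => //; first exact: cvgB.
  apply: cvg_near_cst; near=> x; apply: FP2; apply/andP; split.
    by near: x; exact: nbhs_right_gt.
  by near: x; exact: nbhs_right_lt.
have FPT : F T - P T = F (T / 2) - P (T / 2).
  apply: (@cvg_unique _ (@norm_hausdorff _ _) ((F x - P x) @[x --> T^'-])) => //; first exact: cvgB.
  apply: cvg_near_cst; near=> x; apply: FP2; apply/andP; split.
    by near: x; exact: nbhs_left_gt.
  by near: x; exact: nbhs_left_lt.
have P0 : P 0 = 0 by rewrite /P /parameterized_integral set_itv1 Rintegral_set1.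
move=> t /andP[t0 tT]; rewrite -/(P t).
have : F t - P t = F (T / 2) - P (T / 2).
  move: t0 tT; rewrite !le_eqVlt => /predU1P[<-//|t0] /predU1P[->//|tT].
  by apply: FP2; rewrite t0.
by rewrite -FP0 P0 subr0 => /(canRL (subrK _)).
Unshelve. all: by end_near. Qed.

End du_bois_reymond.

(** Let c be the supremum of the points reached from [a]. The local hypothesis at c links a reached
    point close to c with min(b, c + dl/2), which is therefore reached and cannot exceed c; hence it
    is b. *)
Lemma cousin_interval (R : realType) (P : R -> R -> Prop) (a b : R) : a <= b ->
  (forall s r t, P s r -> P r t -> P s t) ->
  (forall x, a <= x <= b -> exists2 dl, 0 < dl & forall s t,
     a <= s -> s <= t -> t <= b -> `|s - x| < dl -> `|t - x| < dl -> P s t) ->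
  P a b.
Proof.
move=> ab tr loc; pose S := [set t | a <= t <= b /\ P a t].
have Sa : S a.
  split; first by rewrite lexx.
  have [|dl dl0 Pdl] := loc a; first by rewrite lexx.
  by apply: Pdl; rewrite ?subrr ?normr0.
have bS : has_sup S by split; [exists a|exists b => t [/andP[]]].
have cb : sup S <= b by apply: ge_sup; [exists a|move=> t [/andP[]]].
have ac : a <= sup S by exact: ub_le_sup bS.2 _ Sa.
have [|dl dl0 Pdl] := loc (sup S); first by rewrite ac.
have [s [/andP[as_ sb] Ps] cs] := sup_adherent dl0 bS.
have sc : s <= sup S by apply: ub_le_sup bS.2 _ _; split=> //; rewrite as_.
pose t := Num.min b (sup S + dl / 2).
have ct : sup S <= t by rewrite le_min cb lerDl divr_ge0// ltW.
have tb : t <= b by rewrite ge_min lexx.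
have St : S t.
  split; first by rewrite (le_trans ac).
  apply: tr Ps _; apply: Pdl => //; first exact: le_trans ct.
    by rewrite distrC ger0_norm ?subr_ge0// ltrBlDr -ltrBlDl.
  rewrite ger0_norm ?subr_ge0// ltrBlDl (@le_lt_trans _ _ (sup S + dl / 2))//.
    by rewrite ge_min lexx orbT.
  by rewrite ltrD2l ltr_pdivrMr// ltr_pMr// ltr1n.
have tc : t <= sup S by exact: ub_le_sup bS.2 _ St.
suff -> : b = t by exact: St.2.
apply/eqP; rewrite eq_le tb andbT leNgt; apply/negP => tb'.
move: tc; rewrite leNgt => /negP; apply.
have : sup S + dl / 2 <= t.
  have [bc|cb'] := leP b (sup S + dl / 2); last by rewrite /t (min_r (ltW cb')).
  by move: tb'; rewrite /t min_l// ltxx.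
by apply: lt_le_trans; rewrite ltrDl divr_gt0.
Qed.

Section energy.
Context {R : realType} (d : nat) (Omega : set 'rV[R]_d) (T : R).
Hypothesis mO : measurable Omega.
Hypothesis T0 : 0 < T.
Local Notation lam := (@lebesgue_measure R).
Local Notation L2 := (L2 Omega).
Local Notation ip := (ip Omega).
Local Notation L2norm := (L2norm Omega).

Lemma continuous_time_real (e : R -> 'rV[R]_d -> R) (F : R -> R) (C : R) :
  continuous_time Omega T e ->
  (forall s t, 0 <= s <= T -> 0 <= t <= T ->
    `|F s - F t| <= C * L2norm (e s \- e t)) ->
  {within `[0, T], continuous F}.
Proof.
move=> ce HF; apply/subspace_continuousP => t /=; rewrite in_itv/= => t0T.
have cvg0 : C * L2norm (e s \- e t) @[s --> within `[0, T] (nbhs t)] --> (0 : R).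
  rewrite -[X in _ --> X](mulr0 C); apply: cvgM; first exact: cvg_cst.
  exact: ce.
apply/cvgrPdist_le => eps eps0.
have /cvgrPdist_le /(_ _ eps0) := cvg0.
rewrite !near_withinE; apply: filterS => s /[swap] s0T /(_ s0T).
rewrite sub0r normrN => /(le_trans (ler_norm _)); apply: le_trans.
by rewrite distrC; apply: HF => //; move: s0T; rewrite /= in_itv.
Qed.

Lemma continuous_time_L2norm (e : R -> 'rV[R]_d -> R) :
  continuous_time Omega T e -> (forall t, 0 <= t <= T -> L2 (e t)) ->
  {within `[0, T], continuous (fun t => L2norm (e t))}.
Proof.
move=> ce Le; apply: (@continuous_time_real e _ 1) => // s t hs ht.
by rewrite mul1r; exact: nrm_dist (Le _ hs) (Le _ ht).
Qed.

Lemma continuous_time_ip (e : R -> 'rV[R]_d -> R) v :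
  continuous_time Omega T e -> (forall t, 0 <= t <= T -> L2 (e t)) -> L2 v ->
  {within `[0, T], continuous (fun t => ip (e t) v)}.
Proof.
move=> ce Le Lv; apply: (@continuous_time_real e _ (L2norm v)) => // s t hs ht.
rewrite -(iprodBl mO (Le _ hs) (Le _ ht) Lv) mulrC.
by apply: cauchy_schwarz => //; exact: sqiB (Le _ hs) (Le _ ht).
Qed.

(** Let h(t) = ||e(t)||^2 - 2 int_0^t g and M(t) = int_0^t m. Near every point, |h(s) - h(r)| <= eps
    (M(s) - M(r)); this relation passes to adjacent intervals by the triangle inequality, so it
    holds on [0, t], and eps is arbitrary. *)
Lemma energy_identity (e e' : R -> 'rV[R]_d -> R) (m g : R -> R) :
  (forall t, 0 <= t <= T -> L2 (e t)) -> (forall t, 0 <= t <= T -> L2 (e' t)) ->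
  continuous_time Omega T e ->
  lam.-integrable `[0, T] (EFin \o m) ->
  {ae lam, forall t, 0 <= t <= T -> L2norm (e' t) <= m t} ->
  lam.-integrable `[0, T] (EFin \o g) ->
  {ae lam, forall t, 0 <= t <= T -> ip (e' t) (e t) = g t} ->
  (forall v, L2 v -> exists G, [/\ lam.-integrable `[0, T] (EFin \o G),
     {ae lam, forall t, 0 <= t <= T -> ip (e' t) v = G t} &
     forall t, 0 <= t <= T ->
       ip (e t) v = ip (e 0) v + \int[lam]_(x in `[0, t]) G x]) ->
  forall t, 0 <= t <= T ->
    L2norm (e t) ^+ 2 = L2norm (e 0) ^+ 2 + 2 * \int[lam]_(x in `[0, t]) g x.
Proof.
move=> Le Le' ce im mP ig gP He.
have cancelD (x y z : R) : (z + x) - (z + y) = x - y by ring.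
have sub s t : 0 <= s -> t <= T -> `]s, t] `<=` (`[0, T] : set R).
  move=> s0 tT x /=; rewrite !in_itv/= => /andP[sx xt].
  by rewrite (le_trans s0 (ltW sx)) (le_trans xt).
have sub0 t : t <= T -> `[0, t] `<=` (`[0, T] : set R).
  by move=> tT x /=; rewrite !in_itv/= => /andP[-> xt]; rewrite (le_trans xt).
have incr (k : R -> R) s t : lam.-integrable `[0, T] (EFin \o k) ->
    0 <= s -> s <= t -> t <= T ->
    \int[lam]_(x in `[0, t]) k x - \int[lam]_(x in `[0, s]) k x =
    \int[lam]_(x in `]s, t]) k x.
  move=> ik s0 st tT; rewrite Rintegral_itvB ?bnd_simp//.
  by apply: integrableS ik => //; exact: sub0.
pose h t := L2norm (e t) ^+ 2 - 2 * \int[lam]_(x in `[0, t]) g x.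
pose M t := \int[lam]_(x in `[0, t]) m x.
have local eps t : 0 < eps -> 0 <= t <= T -> `|h t - h 0| <= eps * (M t - M 0).
  move=> eps0 /andP[t0 tT].
  pose P r s := `|h s - h r| <= eps * (M s - M r).
  apply: (@cousin_interval R P 0 t t0).
    move=> s r t' Psr Prt; rewrite /P.
    rewrite -(subrKA (h r) (h t') (- h s)) -(subrKA (M r) (M t') (- M s)) mulrDr.
    by apply: le_trans (ler_normD _ _) _; exact: lerD.
  move=> x /andP[x0 xt]; have x0T : 0 <= x <= T by rewrite x0 (le_trans xt).
  (* A distance eps/4 to e x gives eps/2 between two values near x, and two such differences, from e
     s and e r to e y, add up to eps. *)
  have /cvgrPdist_le /(_ (eps / 4)) := ce x x0T.
  rewrite divr_gt0// => /(_ isT); rewrite near_withinE => -[dl /= dl0 Hdl].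
  exists dl => // r s r0 rs st rx sx; rewrite /P.
  have sT : s <= T := le_trans st tT.
  have close y : 0 <= y <= T -> `|y - x| < dl -> L2norm (e y \- e x) <= eps / 4.
    move=> y0T yx; have := Hdl y; rewrite /= distrC in_itv/= => /(_ yx y0T).
    by rewrite sub0r normrN; exact: le_trans (ler_norm _).
  have r0T : 0 <= r <= T by rewrite r0 (le_trans rs).
  have s0T : 0 <= s <= T by rewrite (le_trans r0).
  have Lr := Le _ r0T; have Ls := Le _ s0T.
  (* The scalar identity is used with the fixed vector e s + e r: its pairing with e s - e r is the
     difference of the squared norms. *)
  have Lv := sqiD mO Ls Lr; have [G [iG GP eG]] := He _ Lv.
  have hE : h s - h r = \int[lam]_(y in `]r, s]) (G y - 2 * g y).
    have -> : h s - h r = (L2norm (e s) ^+ 2 - L2norm (e r) ^+ 2) -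
        2 * (\int[lam]_(x in `[0, s]) g x - \int[lam]_(x in `[0, r]) g x).
      by rewrite /h; ring.
    have -> : L2norm (e s) ^+ 2 - L2norm (e r) ^+ 2 =
        ip (e s) (e s \+ e r) - ip (e r) (e s \+ e r).
      rewrite !sqr_nrm /ip; have := iprodDr mO Ls Lr Ls; have := iprodDr mO Ls Lr Lr.
      rewrite /iprod => -> ->.
      have := iprodC (leb R d) Omega (e r) (e s); rewrite /iprod => ->; ring.
    rewrite (eG s s0T) (eG r r0T) cancelD (incr G r s iG r0 rs sT).
    rewrite (incr g r s ig r0 rs sT).
    have iG' : lam.-integrable `]r, s] (EFin \o G).
      by apply: integrableS iG => //; exact: sub.
    have ig' : lam.-integrable `]r, s] (EFin \o g).
      by apply: integrableS ig => //; exact: sub.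
    rewrite RintegralB ?RintegralZl//.
    by have := integrableZl _ 2%R ig'; apply.
  have iD : lam.-integrable `]r, s] (EFin \o (fun y => G y - 2 * g y)).
    have iD' : lam.-integrable `[0, T] (EFin \o (fun y => G y - 2 * g y)).
      have i2g : lam.-integrable `[0, T] (EFin \o (fun y => 2 * g y)).
        by have := integrableZl _ 2%R ig; apply.
      by have := integrableB _ iG i2g; apply.
    by apply: integrableS iD' => //; exact: sub.
  have im' : lam.-integrable `]r, s] (EFin \o m).
    by apply: integrableS im => //; exact: sub.
  rewrite hE (incr _ _ _ im)// -RintegralZl//.
  apply: le_trans (le_normr_Rintegral _ _) _ => //.
  apply: ae_le_Rintegral => //.
  - exact: integrable_norm.
  - by have := integrableZl _ eps im'; apply.
  apply: filterS3 GP gP mP => y Gy gy my /=; rewrite in_itv/= => /andP[ry ys].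
  have y0T : 0 <= y <= T by rewrite (le_trans r0 (ltW ry)) (le_trans ys).
  have Ly := Le _ y0T; have Ly' := Le' _ y0T; have Lx := Le _ x0T.
  rewrite -(Gy y0T) -(gy y0T); have m_ge := my y0T.
  have yx : `|y - x| < dl.
    move: rx sx; rewrite !ltr_distl => /andP[rx1 rx2] /andP[sx1 sx2].
    by rewrite (lt_trans rx1 ry) (le_lt_trans ys sx2).
  have dist z : 0 <= z <= T -> `|z - x| < dl -> L2norm (e z \- e y) <= eps / 2.
    move=> z0T zx; have Lz := Le _ z0T.
    rewrite (_ : e z \- e y = (e z \- e x) \+ (e x \- e y)); last first.
      by apply/funext => k /=; rewrite subrKA.
    have := nrmD mO (sqiB mO Lz Lx) (sqiB mO Lx Ly).
    move=> /le_trans; apply; rewrite (_ : eps / 2 = eps / 4 + eps / 4); last by field.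
    by apply: lerD; [exact: close|rewrite nrmBC; exact: close].
  (* The factor 2 of the chain rule is split between the two endpoints, so that only increments of e
     over the short interval remain. *)
  have -> : ip (e' y) (e s \+ e r) - 2 * ip (e' y) (e y) =
      ip (e' y) ((e s \- e y) \+ (e r \- e y)).
    have := iprodDr mO Ls Lr Ly'.
    have := iprodDr mO (sqiB mO Ls Ly) (sqiB mO Lr Ly) Ly'.
    have := iprodBr mO Ls Ly Ly'; have := iprodBr mO Lr Ly Ly'.
    rewrite /iprod /ip => E1 E2 E3 E4; rewrite E3 E4 E1 E2; ring.
  have Ld := sqiD mO (sqiB mO Ls Ly) (sqiB mO Lr Ly).
  apply: le_trans (cauchy_schwarz mO Ly' Ld) _; rewrite mulrC.
  apply: ler_pM => //; [exact: nrm_ge0|exact: nrm_ge0|].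
  apply: le_trans (nrmD mO (sqiB mO Ls Ly) (sqiB mO Lr Ly)) _.
  by rewrite [leRHS](splitr eps); apply: lerD; exact: dist.
move=> t t0T.
have int0 (k : R -> R) : \int[lam]_(x in `[0, 0]) k x = 0.
  by rewrite set_itv1 Rintegral_set1.
suff : h t = h 0 by rewrite /h int0 mulr0 subr0 => /(canRL (subrK _)).
apply/eqP; rewrite -subr_eq0 -normr_le0; apply/ler_addgt0Pl => eps eps0.
rewrite addr0; have := local (eps / (`|M t - M 0| + 1)) t.
have D0 : 0 < `|M t - M 0| + 1 by rewrite ltr_wpDl.
rewrite divr_gt0// => /(_ isT t0T) /le_trans; apply.
rewrite -mulrA ger_pMr// mulrC ler_pdivrMr// mul1r.
by apply: le_trans (ler_norm _) _; rewrite lerDl.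
Qed.

End energy.

(** [mu] is not supposed complete, so an a.e. limit is measurable only after being set to 0 on a
    measurable null set. *)
Lemma ae_cvg_measurable d (X : measurableType d) (R : realType)
    (mu : {measure set X -> \bar R}) (D : set X) (h : nat -> X -> R) (f : X -> R) :
  measurable D -> (forall n, measurable_fun D (h n)) ->
  {ae mu, forall x, D x -> h n x @[n --> \oo] --> f x} ->
  exists2 g, measurable_fun D g & {ae mu, forall x, D x -> f x = g x}.
Proof.
move=> mD mh [M [mM M0 hM]]; have mM' : measurable (~` M) by exact: measurableC.
exists (f \_ (~` M)).
  apply: (@measurable_fun_cvg _ _ _ _ (fun n => h n \_ (~` M))) => [n|x Dx].
    by apply/measurable_restrict => //; apply: measurable_funS (mh n).
  rewrite patchE; case: ifPn => [/set_mem xM|xM].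
    under eq_fun do rewrite patchE mem_set//.
    by apply: contrapT => hf; apply: xM; apply: hM => /= /(_ Dx).
  by under eq_fun do rewrite patchE (negbTE xM); exact: cvg_cst.
exists M; split => // x /= /not_implyP[Dx fx]; apply: contrapT => xM; apply: fx.
by rewrite patchE mem_set.
Qed.

(** * Measurability in time of pairings and norms of strongly measurable paths *)

Section strongly_measurable.
Context {R : realType} (d : nat) (Omega : set 'rV[R]_d) (T : R).
Hypothesis mO : measurable Omega.
Local Notation lam := (@lebesgue_measure R).
Local Notation L2 := (L2 Omega).
Local Notation ip := (ip Omega).
Local Notation L2norm := (L2norm Omega).
Implicit Types u e : R -> 'rV[R]_d -> R.

Lemma ip_sum (I : Type) (s : seq I) (b : I -> R) (c : I -> 'rV[R]_d -> R) z :
  (forall i, L2 (c i)) -> L2 z ->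
  L2 (fun x => \sum_(i <- s) b i * c i x) /\
  ip (fun x => \sum_(i <- s) b i * c i x) z = \sum_(i <- s) b i * ip (c i) z.
Proof.
move=> Lc Lz; elim: s => [|i s [IHL IHs]].
  rewrite (_ : (fun x => _) = fun=> 0); last first.
    by apply/funext => x; rewrite big_nil.
  split; first exact: sqi0.
  rewrite big_nil /ip /Rintegral integral0_eq// => x _.
  by rewrite mul0r.
rewrite (_ : (fun x => _) = (fun x => b i * c i x) \+
    (fun x => \sum_(i <- s) b i * c i x)); last first.
  by apply/funext => x; rewrite big_cons.
have Lbc : L2 (fun x => b i * c i x) := sqiZ mO (b i) (Lc i).
split; first by have := sqiD mO Lbc IHL.
rewrite big_cons -IHs; have := iprodDl mO Lbc IHL Lz; rewrite /iprod -/(ip _ _) => ->.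
by congr (_ + _); exact: iprodZl (Lc i) Lz.
Qed.

(** The pairing is a finite sum of indicators times <e(t), c_k>. Only the pairings of [e] with fixed
    vectors have to be measurable, so [e] may be a continuous path or a simple path again. *)
Lemma simple_pathE s : simple_path Omega s ->
  (forall t, L2 (s t)) /\
  forall e, (forall v, L2 v -> measurable_fun `[0, T] (fun t => ip (e t) v)) ->
    (forall t, 0 <= t <= T -> L2 (e t)) ->
    measurable_fun `[0, T] (fun t => ip (s t) (e t)).
Proof.
move=> [m [E [c [Ec sE]]]].
have sE' t : s t = fun x => \sum_k \1_(E k) t * c k x by apply/funext.
have Lc k : L2 (c k) := (Ec k).2.
split=> [t|e me Le].
  rewrite sE'; exact: (ip_sum _ (fun k => \1_(E k) t) Lc (sqi0 _ _)).1.
apply: (@eq_measurable_fun _ _ _ _ _ (fun t => \sum_k \1_(E k) t * ip (e t) (c k))).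
  move=> t; rewrite inE/= in_itv/= => t0T; rewrite sE'.
  rewrite (ip_sum _ (fun k => \1_(E k) t) Lc (Le _ t0T)).2.
  by apply: eq_bigr => k _; congr (_ * _); exact: iprodC.
apply: measurable_sum => k; apply: measurable_funM.
  exact: measurable_indic (Ec k).1.
exact: me.
Qed.

Lemma continuous_time_ip_measurable e v :
  continuous_time Omega T e -> (forall t, 0 <= t <= T -> L2 (e t)) -> L2 v ->
  measurable_fun `[0, T] (fun t => ip (e t) v).
Proof.
move=> ce Le Lv; apply: subspace_continuous_measurable_fun => //.
exact: continuous_time_ip.
Qed.

Lemma strongly_measurable_ip u e :
  strongly_measurable Omega T u -> (forall t, 0 <= t <= T -> L2 (u t)) ->
  continuous_time Omega T e -> (forall t, 0 <= t <= T -> L2 (e t)) ->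
  exists2 g, measurable_fun `[0, T] g &
    {ae lam, forall t, 0 <= t <= T -> ip (u t) (e t) = g t}.
Proof.
move=> [s [ss su]] Lu ce Le.
suff [g mg gE] : exists2 g, measurable_fun `[0, T] g &
    {ae lam, forall t, `[0, T]%classic t -> ip (u t) (e t) = g t}.
  by exists g => //; apply: filterS gE => t gt t0T; apply: gt; rewrite /= in_itv.
apply: (@ae_cvg_measurable _ _ _ lam _ (fun n t => ip (s n t) (e t))) => //.
  move=> n; apply: (simple_pathE (ss n)).2 => // v Lv.
  exact: continuous_time_ip_measurable.
apply: filterS su => t sut; rewrite /= in_itv/= => t0T.
have Ls n : L2 (s n t) := (simple_pathE (ss n)).1 t.
apply/cvgrPdist_le => eps eps0.
have cv : L2norm (s n t \- u t) * L2norm (e t) @[n --> \oo] --> (0 : R).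
  rewrite -[X in _ --> X](mul0r (L2norm (e t))).
  by apply: cvgM; [exact: sut|exact: cvg_cst].
have /cvgrPdist_le /(_ _ eps0) := cv.
apply: filterS => n; rewrite sub0r normrN => /(le_trans (ler_norm _)).
apply: le_trans; rewrite distrC.
have := cauchy_schwarz mO (sqiB mO (Ls n) (Lu _ t0T)) (Le _ t0T).
by rewrite (iprodBl mO (Ls n) (Lu _ t0T) (Le _ t0T)).
Qed.

Lemma strongly_measurable_L2norm u :
  strongly_measurable Omega T u -> (forall t, 0 <= t <= T -> L2 (u t)) ->
  exists2 g, measurable_fun `[0, T] g &
    {ae lam, forall t, 0 <= t <= T -> L2norm (u t) = g t}.
Proof.
move=> [s [ss su]] Lu.
suff [g mg gE] : exists2 g, measurable_fun `[0, T] g &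
    {ae lam, forall t, `[0, T]%classic t -> L2norm (u t) = g t}.
  by exists g => //; apply: filterS gE => t gt t0T; apply: gt; rewrite /= in_itv.
apply: (@ae_cvg_measurable _ _ _ lam _ (fun n t => L2norm (s n t))) => //.
  move=> n; have msq := continuous_measurable_fun (@sqrt_continuous R).
  apply: (measurableT_comp msq).
  have [Ls ms] := simple_pathE (ss n).
  (* The squared norm is the pairing of [s n] with itself; the weak measurability this requires
     comes from the same fact for the constant path [v]. *)
  apply: (ms) => // v Lv.
  by apply: (ms (fun=> v)) => // z Lz; exact: measurable_cst.
apply: filterS su => t sut; rewrite /= in_itv/= => t0T.
have Ls n : L2 (s n t) := (simple_pathE (ss n)).1 t.
apply/cvgrPdist_le => eps eps0.
have /cvgrPdist_le /(_ _ eps0) := sut t0T.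
apply: filterS => n; rewrite sub0r normrN => /(le_trans (ler_norm _)).
by apply: le_trans; rewrite distrC; exact: nrm_dist (Ls n) (Lu _ t0T).
Qed.

End strongly_measurable.

(** * The error equation at a fixed time *)

Section discrete_space.
Context {R : realType} (d : nat) (Omega : set 'rV[R]_d).
Hypothesis mO : measurable Omega.
Hypothesis finO : (leb R d Omega < +oo)%E.
Variables (Th : mesh Omega) (p : nat).
Implicit Types v z : 'rV[R]_d -> R.
Local Notation mu := (leb R d).

Lemma poly_funZD s (c : R) q r : poly_fun s p q -> poly_fun s p r ->
  poly_fun s p (fun x : 'rV[R]_d => c * q x + r x).
Proof.
move=> [a aE] [b bE]; exists (fun al => c * a al + b al) => x.
rewrite aE bE mulr_sumr -big_split/=; apply: eq_bigr => al _.
by rewrite mulrDl mulrA.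
Qed.

Lemma ShZD (c : R) v z : Sh Th p v -> Sh Th p z ->
  Sh Th p (fun x => c * v x + z x).
Proof.
move=> [Lv Pv] [Lz Pz]; split; first by have := sqiD mO (sqiZ mO c Lv) Lz.
move=> k; have [q Pq vq] := Pv k; have [r Pr zr] := Pz k.
exists (fun x => c * q x + r x); first exact: poly_funZD.
by apply: filterS2 vq zr => x vq zr kx; rewrite vq// zr.
Qed.

Lemma ShD v z : Sh Th p v -> Sh Th p z -> Sh Th p (v \+ z).
Proof.
move=> Sv Sz; rewrite (_ : _ \+ _ = fun x => 1 * v x + z x); first exact: ShZD.
by apply/funext => x; rewrite mul1r.
Qed.

Lemma ShB v z : Sh Th p v -> Sh Th p z -> Sh Th p (v \- z).
Proof.
move=> Sv Sz; rewrite (_ : _ \- _ = fun x => -1 * z x + v x); first exact: ShZD.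
by apply/funext => x; rewrite mulN1r addrC.
Qed.

Lemma SH_add s z : Sh Th p s -> H10 Omega z -> SH Th p (fun x => s x + z x).
Proof.
move=> Ss Hz; split; first by have := sqiD mO Ss.1 (H10_L2 Hz).
by exists s, z; split => //; exact: aeW.
Qed.

(** [SH] asks for a summand in each space; the zero of [H10] is produced as z - z. *)
Lemma Sh_SH s z : Sh Th p s -> H10 Omega z -> SH Th p s.
Proof.
move=> Ss Hz; have := SH_add Ss (H10B mO finO Hz Hz).
by congr SH; apply/funext => x /=; rewrite subrr addr0.
Qed.

Lemma H10_SH s z : Sh Th p s -> H10 Omega z -> SH Th p z.
Proof.
move=> Ss Hz; have := SH_add (ShB Ss Ss) Hz.
by congr SH; apply/funext => x /=; rewrite subrr add0r.
Qed.

Lemma bilinear_onBl (B : ('rV[R]_d -> R) -> ('rV[R]_d -> R) -> R) v v' z :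
  bilinear_on Th p B -> SH Th p v -> SH Th p v' -> SH Th p z ->
  B (v \- v') z = B v z - B v' z.
Proof.
move=> [_ Bl _] Sv Sv' Sz; rewrite (_ : v \- v' = fun x => -1 * v' x + v x).
  by rewrite Bl// mulN1r addrC.
by apply/funext => x; rewrite mulN1r addrC.
Qed.

Lemma bilinear_onDl (B : ('rV[R]_d -> R) -> ('rV[R]_d -> R) -> R) v v' z :
  bilinear_on Th p B -> SH Th p v -> SH Th p v' -> SH Th p z ->
  B (v \+ v') z = B v z + B v' z.
Proof.
move=> [_ Bl _] Sv Sv' Sz; rewrite (_ : v \+ v' = fun x => 1 * v x + v' x).
  by rewrite Bl// mul1r.
by apply/funext => x; rewrite mul1r.
Qed.

Section pointwise_in_time.
Variables (B : ('rV[R]_d -> R) -> ('rV[R]_d -> R) -> R) (N : ('rV[R]_d -> R) -> R).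
Hypothesis hB : bilinear_on Th p B.
Hypothesis hN : norm_on Th p N.
Hypothesis symB : forall v z, H10 Omega v -> H10 Omega z -> B v z = B z v.
Hypothesis NB : forall v, H10 Omega v -> N v ^+ 2 = B v v.
Variables u w U Uc Ud u' U' Ud' f Pf AU : 'rV[R]_d -> R.
Hypotheses (Hu : H10 Omega u) (Hw : H10 Omega w) (SU : Sh Th p U).
Hypotheses (HUc : H10 Omega Uc) (SUd : Sh Th p Ud).
Hypothesis UdE : eq_on Omega Ud (U \- Uc).
Hypotheses (Lu' : L2 Omega u') (SU' : Sh Th p U') (LUd' : L2 Omega Ud').
Hypotheses (Lf : L2 Omega f) (SPf : Sh Th p Pf) (SAU : Sh Th p AU).
Hypothesis weak : forall v, H10 Omega v -> ip Omega u' v + B u v = ip Omega f v.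
Hypothesis scheme : forall V, Sh Th p V -> ip Omega U' V + B U V = ip Omega f V.
Hypothesis PfE : forall V, Sh Th p V -> ip Omega Pf V = ip Omega f V.
Hypothesis AUE : forall V, Sh Th p V -> ip Omega AU V = B U V.
Hypothesis recon : forall v, H10 Omega v ->
  B w v = ip Omega (fun x => AU x - Pf x + f x) v.

(* By the scheme, [AU - Pf = - U'] as elements of S. *)
Lemma reconstruction_rhs v : H10 Omega v -> B w v = ip Omega f v - ip Omega U' v.
Proof.
move=> Hv; have Lv := H10_L2 Hv; rewrite recon//.
(* [Z] lies in S and is orthogonal to S, by the scheme and the definitions of A and Pi; tested with
   itself it has norm 0. It vanishes only almost everywhere, so it is removed from pairings by
   Cauchy-Schwarz. *)
pose Z := (U' \+ AU) \- Pf.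
have SZ : Sh Th p Z by apply: ShB => //; exact: ShD.
have Z0 : nrm (leb R d) Omega Z = 0.
  apply/eqP; rewrite -sqrf_eq0 sqr_nrm; apply/eqP.
  have E1 := iprodBl mO (sqiD mO SU'.1 SAU.1) SPf.1 SZ.1.
  have E2 := iprodDl mO SU'.1 SAU.1 SZ.1.
  have := scheme SZ; have := PfE SZ; have := AUE SZ.
  rewrite /ip -!/(iprod (leb R d) Omega _ _) => E3 E4.
  by rewrite E1 E2 E3 E4 => ->; rewrite subrr.
have ZV : iprod (leb R d) Omega Z v = 0.
  apply/eqP; rewrite -normr_le0; apply: le_trans (cauchy_schwarz mO SZ.1 Lv) _.
  by rewrite Z0 mul0r.
have E : (fun x => AU x - Pf x + f x) = (f \- U') \+ Z.
  by apply/funext => x; rewrite /Z /=; ring.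
have E1 := iprodDl mO (sqiB mO Lf SU'.1) SZ.1 Lv.
have E2 := iprodBl mO Lf SU'.1 Lv.
by rewrite E /ip -!/(iprod (leb R d) Omega _ _) E1 ZV addr0 E2.
Qed.

Lemma energy_inequality :
  2 * ip Omega (u' \- U' \+ Ud') (u \- U \+ Ud) +
    Num.max 0 (N (u \- U) - N (w \- U)) ^+ 2 <=
  (N (w \- U) + N Ud) ^+ 2 +
    2 * (L2norm Omega Ud' * L2norm Omega (u \- U \+ Ud)).
Proof.
pose rho := u \- w; pose th := w \- Uc; pose ec := u \- Uc.
have Hrho : H10 Omega rho by exact: H10B.
have Hth : H10 Omega th by exact: H10B.
have Hec : H10 Omega ec by exact: H10B.
have SHu := H10_SH SU Hu; have SHw := H10_SH SU Hw.
have SHrho := H10_SH SU Hrho; have SHth := H10_SH SU Hth.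
have SHec := H10_SH SU Hec.
have SHwU : SH Th p (w \- U).
  have := SH_add (ShB (ShB SU SU) SU) Hw.
  by congr SH; apply/funext => x /=; rewrite subrr sub0r addrC.
have [Nae N0 _ _ Ntri] := hN.
have N_th : N th <= N (w \- U) + N Ud.
  have SHUd := Sh_SH SUd Hu; apply: le_trans (Ntri _ _ SHwU SHUd).
  rewrite le_eqVlt; apply/orP; left; apply/eqP; apply: Nae => //.
    have := SH_add (ShB SUd SU) Hw; congr SH; apply/funext => x /=; ring.
  by apply: filterS (UdE) => x Udx Ox; rewrite /= Udx//= /th/=; ring.
have N_uU : N (u \- U) <= N rho + N (w \- U).
  apply: le_trans (Ntri _ _ SHrho SHwU); rewrite le_eqVlt; apply/orP; left.
  by apply/eqP; congr N; apply/funext => x /=; rewrite /rho/= subrKA.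
have r_le : Num.max 0 (N (u \- U) - N (w \- U)) ^+ 2 <= N rho ^+ 2.
  rewrite lerXn2r ?nnegrE ?N0// ?le_max ?lexx//.
  by rewrite ge_max N0//= lerBlDr.
have th_le : N th ^+ 2 <= (N (w \- U) + N Ud) ^+ 2.
  by rewrite lerXn2r ?nnegrE ?addr_ge0 ?N0//; exact: Sh_SH SUd Hu.
have ecE : ec = rho \+ th by apply/funext => x; rewrite /ec /rho /th/= subrKA.
have Bre : B rho ec = B rho rho + B rho th.
  by rewrite symB// ecE bilinear_onDl// (symB Hth).
have Bte : B th ec = B rho th + B th th.
  by rewrite (symB Hth Hec) [in LHS]ecE bilinear_onDl.
(* This is |||rho + theta|||^2 >= 0 expanded. Adding it to |||rho|||^2 - |||theta|||^2 gives 2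
   B(rho, rho + theta), the source of the lower bound for the latter. *)
have ec0 : 0 <= B rho rho + B rho th + (B rho th + B th th).
  rewrite -Bre -Bte -bilinear_onDl// -ecE -NB//; exact: sqr_ge0.
(* [Ud] equals U - U_c only almost everywhere, so the equation is tested with [ec], which is in
   [H10]; norms and pairings do not distinguish the two. *)
have eE : ae_eq (leb R d) Omega (u \- U \+ Ud) ec.
  by apply: filterS (UdE) => x Udx Ox; rewrite /= Udx//= /ec/=; ring.
have Lec := H10_L2 Hec.
have -> : L2norm Omega (u \- U \+ Ud) = L2norm Omega ec by exact: nrm_ae eE.
have -> : ip Omega (u' \- U' \+ Ud') (u \- U \+ Ud) =
    ip Omega u' ec - ip Omega U' ec + ip Omega Ud' ec.
  have E1 := iprodBl mO Lu' SU'.1 Lec.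
  have E2 := iprodDl mO (sqiB mO Lu' SU'.1) LUd' Lec.
  rewrite /ip -!/(iprod (leb R d) Omega _ _) -E1 -E2.
  apply: iprod_ae => //; exact: ae_eq_refl.
have Brho : B rho ec = ip Omega U' ec - ip Omega u' ec.
  rewrite bilinear_onBl// reconstruction_rhs//.
  by have := weak Hec; move=> /(canRL (addKr _)) ->; ring.
have CS : ip Omega Ud' ec <= L2norm Omega Ud' * L2norm Omega ec.
  exact: le_trans (ler_norm _) (cauchy_schwarz mO LUd' Lec).
move: r_le th_le; rewrite !NB// => r_le th_le.
move: Brho; rewrite Bre => Brho.
move: r_le th_le ec0 CS Brho.
generalize (ip Omega U' ec) (ip Omega u' ec) (ip Omega Ud' ec).
generalize (L2norm Omega Ud' * L2norm Omega ec).
generalize (B rho rho) (B rho th) (B th th).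
generalize (Num.max 0 (N (u \- U) - N (w \- U)) ^+ 2).
generalize ((N (w \- U) + N Ud) ^+ 2).
by move=> *; lra.
Qed.

End pointwise_in_time.
End discrete_space.

(** * Symmetry of the form and the energy norm at almost every time *)

Section coefficient.
Context {R : realType} (d : nat) (Omega : set 'rV[R]_d) (T : R).
Local Notation mu := (leb R d).
Local Notation lam := (@lebesgue_measure R).

Lemma dotvE n (x y : 'rV[R]_n) : dotv x y = (x *m y^T) ord0 ord0.
Proof. by rewrite mxE; apply: eq_bigr => i _; rewrite mxE. Qed.

Lemma spd_sym (M : 'M[R]_d) g h : spd M ->
  dotv (actv M g) h = dotv (actv M h) g.
Proof.
move=> [MT _]; rewrite !dotvE /actv MT.
have -> : h *m M *m g^T = (g *m M *m h^T)^T.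
  by rewrite !trmx_mul trmxK MT mulmxA.
by rewrite [RHS]mxE.
Qed.

Lemma is_sqrtmx_dotv (M s : 'M[R]_d) g : is_sqrtmx M s ->
  dotv (actv s g) (actv s g) = dotv (actv M g) g.
Proof.
move=> [sT _ <-]; by rewrite !dotvE /actv !trmx_mul !sT !mulmxA.
Qed.

Lemma ae_time_set1 (a : R) : {ae lam, forall t, t != a}.
Proof.
exists [set a]; split; [exact: measurable_set1|exact: lebesgue_measure_set1|].
by move=> t /= /negP; rewrite negbK => /eqP.
Qed.

(** By Tonelli, a null set of the product measure has null sections at almost every time. *)
Lemma ae_space_time_section (P : R -> 'rV[R]_d -> Prop) :
  ae_space_time Omega T P ->
  {ae lam, forall t, 0 <= t <= T -> {ae mu, forall x, Omega x -> P t x}}.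
Proof.
move=> [M [mM M0 PM]].
have mx : measurable_fun setT (mu \o xsection M).
  exact: measurable_fun_xsection.
have : {ae lam, forall t, mu (xsection M t) = 0%E}.
  have : ae_eq lam setT (mu \o xsection M) (cst 0%E).
    apply/ae_eq_integral_abs => //; rewrite -[RHS]M0 /product_measure1.
    by apply: eq_integral => t _; rewrite /= gee0_abs.
  by apply: filterS => t /(_ I).
(* The space-time cylinder is open in time, so the two endpoints are discarded as null sets. *)
have := ae_time_set1 0; have := ae_time_set1 T.
apply: filterS3 => t tT t0 Mt0 /andP[t0' tT'].
exists (xsection M t); split => //; first exact: measurable_xsection.
move=> x /= /not_implyP[Ox Ptx]; rewrite /xsection/= inE; apply: PM => /=.
move=> QP; apply: Ptx; apply: QP; split => //=.
by rewrite !lt_def t0 t0' eq_sym tT tT'.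
Qed.

Variables (Th : mesh Omega) (a sa : R -> 'rV[R]_d -> 'M[R]_d).
Variables (B : R -> ('rV[R]_d -> R) -> ('rV[R]_d -> R) -> R).
Variables (N : R -> ('rV[R]_d -> R) -> R).

(** [a] is symmetric positive definite only almost everywhere in space-time, hence the exceptional
    times. The norm becomes the form through |sqrt(a) g|^2 = (a g) . g. *)
Lemma consistent_symmetric : admissible_coef T a Th -> sqrt_coef Omega T a sa ->
  consistent_on_H10 Omega T a sa B N ->
  {ae lam, forall t, 0 <= t <= T -> forall v z, H10 Omega v -> H10 Omega z ->
    B t v z = B t z v /\ N t v ^+ 2 = B t v v}.
Proof.
move=> [_ aspd _ _ _] [_ saP] BN.
apply: filterS (ae_space_time_section aspd) => t spdt t0T v z [g vg] [h zh].
have {}spdt := spdt t0T.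
rewrite (BN t v z g h t0T vg zh).1 (BN t z v h g t0T zh vg).1.
have [-> ->] := BN t v v g g t0T vg vg; split.
  apply: ae_eq_Rintegral_any; apply: filterS spdt => x spdx Ox.
  by apply: spd_sym; exact: spdx.
rewrite sqr_sqrtr; last first.
  by apply: Rintegral_ge0 => x _; apply: sumr_ge0 => i _; rewrite -expr2 sqr_ge0.
apply: ae_eq_Rintegral_any; apply: filterS spdt => x spdx Ox.
by apply: is_sqrtmx_dotv; apply: saP => //; exact: spdx.
Qed.

End coefficient.

(** * Integration in time *)

Section time_regular.
Context {R : realType} (d : nat) (Omega : set 'rV[R]_d) (T : R).
Hypothesis mO : measurable Omega.
Hypothesis T0 : 0 < T.
Local Notation lam := (@lebesgue_measure R).
Local Notation L2 := (L2 Omega).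
Local Notation ip := (ip Omega).
Local Notation L2norm := (L2norm Omega).
Implicit Types u e : R -> 'rV[R]_d -> R.

Lemma ae_le_integrable (g h : R -> R) : measurable_fun `[0, T] g ->
  lam.-integrable `[0, T] (EFin \o h) ->
  {ae lam, forall t, 0 <= t <= T -> `|g t| <= h t} ->
  lam.-integrable `[0, T] (EFin \o g).
Proof.
move=> mg ih gh; apply/integrableP; split; first exact/measurable_EFinP.
have /integrableP[mh hoo] := ih; apply: le_lt_trans hoo.
apply: ae_ge0_le_integral => //.
- by apply: measurableT_comp => //; exact/measurable_EFinP.
- exact: measurableT_comp.
apply: filterS gh => t ght; rewrite /= in_itv/= => t0T.
by rewrite lee_fin; apply: le_trans (ght t0T) (ler_norm _).
Qed.

Definition time_regular u u' := [/\
  (forall t, 0 <= t <= T -> L2 (u t)) /\ (forall t, 0 <= t <= T -> L2 (u' t)),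
  continuous_time Omega T u,
  exists2 n, lam.-integrable `[0, T] (EFin \o n) &
    {ae lam, forall t, 0 <= t <= T -> L2norm (u' t) <= n t},
  forall e, continuous_time Omega T e -> (forall t, 0 <= t <= T -> L2 (e t)) ->
    exists2 g, lam.-integrable `[0, T] (EFin \o g) &
      {ae lam, forall t, 0 <= t <= T -> ip (u' t) (e t) = g t} &
  forall v, L2 v -> exists G, [/\ lam.-integrable `[0, T] (EFin \o G),
     {ae lam, forall t, 0 <= t <= T -> ip (u' t) v = G t} &
     forall t, 0 <= t <= T ->
       ip (u t) v = ip (u 0) v + \int[lam]_(x in `[0, t]) G x]].

(** The majorant [n] is what varies between the paths: a constant for U', the norm itself for U_d',
    one plus the squared norm for u'. Multiplied by the maximum of ||e|| it dominates the pairing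
    with e. *)
Lemma weak_dt_time_regular u u' n : (forall t, 0 <= t <= T -> L2 (u t)) ->
  (forall t, 0 <= t <= T -> L2 (u' t)) -> continuous_time Omega T u ->
  strongly_measurable Omega T u' -> weak_dt Omega T u u' ->
  lam.-integrable `[0, T] (EFin \o n) ->
  {ae lam, forall t, 0 <= t <= T -> L2norm (u' t) <= n t} ->
  time_regular u u'.
Proof.
move=> Lu Lu' cu su' wu iN nP.
have pairing e : continuous_time Omega T e -> (forall t, 0 <= t <= T -> L2 (e t)) ->
    exists2 g, lam.-integrable `[0, T] (EFin \o g) &
      {ae lam, forall t, 0 <= t <= T -> ip (u' t) (e t) = g t}.
  move=> ce Le; have [g mg gE] := strongly_measurable_ip mO su' Lu' ce Le.
  exists g => //.
  have [c cT Hc] := EVT_max (ltW T0) (continuous_time_L2norm mO ce Le).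
  have iM : lam.-integrable `[0, T] (EFin \o (fun t => L2norm (e c) * n t)).
    by have := integrableZl _ (L2norm (e c)) iN; apply.
  apply: ae_le_integrable mg iM _; apply: filterS2 gE nP => t gt nt t0T.
  rewrite -(gt t0T) mulrC; apply: le_trans (cauchy_schwarz mO (Lu' _ t0T) (Le _ t0T)) _.
  apply: ler_pM; [exact: nrm_ge0|exact: nrm_ge0|exact: nt|].
  by apply: Hc; rewrite in_itv.
split => //; first by exists n.
move=> v Lv; have [||g ig gE] := pairing (fun=> v).
- move=> t t0T; rewrite /continuous_time_at.
  rewrite (_ : (fun=> _) = fun=> 0); first exact: cvg_cst.
  apply/funext => s; rewrite /Defs.L2norm /Defs.ip /Rintegral integral0_eq ?sqrtr0//.
  by move=> x _; rewrite /= subrr mul0r.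
- by [].
exists g; split => //; apply: du_bois_reymond => //.
  exact: continuous_time_ip.
move=> phi tphi; rewrite (wu phi v tphi Lv); congr (- _).
apply: ae_eq_Rintegral_any; apply: filterS gE => t gt.
by rewrite /= in_itv/= => t0T; rewrite gt.
Qed.

Lemma time_regularZD (c : R) u u' e e' : time_regular u u' -> time_regular e e' ->
  time_regular (fun t x => c * u t x + e t x) (fun t x => c * u' t x + e' t x).
Proof.
move=> [[Lu Lu'] cu [n iN nP] pu du] [[Le Le'] ce [m im mP] pe de].
have L t : 0 <= t <= T -> L2 (fun x => c * u t x + e t x).
  by move=> t0T; have := sqiD mO (sqiZ mO c (Lu _ t0T)) (Le _ t0T).
have L' t : 0 <= t <= T -> L2 (fun x => c * u' t x + e' t x).
  by move=> t0T; have := sqiD mO (sqiZ mO c (Lu' _ t0T)) (Le' _ t0T).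
have ipZD (v z y : 'rV[R]_d -> R) : L2 v -> L2 z -> L2 y ->
    ip (fun x => c * v x + z x) y = c * ip v y + ip z y.
  move=> Lv Lz Ly; have E1 := iprodZl mO c Lv Ly.
  by have := iprodDl mO (sqiZ mO c Lv) Lz Ly; rewrite E1.
have iZD (g h : R -> R) : lam.-integrable `[0, T] (EFin \o g) ->
    lam.-integrable `[0, T] (EFin \o h) ->
    lam.-integrable `[0, T] (EFin \o (fun t => c * g t + h t)).
  move=> ig ih.
  have icg : lam.-integrable `[0, T] (EFin \o (fun t => c * g t)).
    by have := integrableZl _ c ig; apply.
  by have := integrableD _ icg ih; apply.
split=> //.
- move=> t t0T; rewrite /continuous_time_at.
  have S : `|c| * L2norm (u s \- u t) + L2norm (e s \- e t)
      @[s --> within `[0, T] (nbhs t)] --> (0 : R).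
    rewrite [X in _ --> X](_ : _ = `|c| * 0 + 0); last by rewrite mulr0 addr0.
    apply: cvgD; last exact: ce.
    by apply: cvgM; [exact: cvg_cst|exact: cu].
  apply: (squeeze_cvgr _ (cvg_cst 0) S); rewrite near_withinE; apply: nearW => s.
  rewrite /= in_itv/= => s0T; rewrite sqrtr_ge0/=.
  have Lus := sqiB mO (Lu _ s0T) (Lu _ t0T).
  have := nrmD mO (sqiZ mO c Lus) (sqiB mO (Le _ s0T) (Le _ t0T)).
  rewrite nrmZ//; apply: le_trans; rewrite le_eqVlt; apply/orP; left.
  by apply/eqP; congr Defs.L2norm; apply/funext => x /=; ring.
- exists (fun t => `|c| * n t + m t).
    have icn : lam.-integrable `[0, T] (EFin \o (fun t => `|c| * n t)).
      by have := integrableZl _ `|c|%R iN; apply.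
    by have := integrableD _ icn im; apply.
  apply: filterS2 nP mP => t nt mt t0T.
  have := nrmD mO (sqiZ mO c (Lu' _ t0T)) (Le' _ t0T).
  rewrite (nrmZ mO c (Lu' _ t0T)) => /le_trans; apply; apply: lerD; last exact: mt.
  by rewrite ler_wpM2l//; exact: nt.
- move=> y cy Ly; have [g ig gE] := pu y cy Ly; have [h ih hE] := pe y cy Ly.
  exists (fun t => c * g t + h t); first exact: iZD.
  apply: filterS2 gE hE => t gt ht t0T.
  by rewrite (ipZD _ _ _ (Lu' _ t0T) (Le' _ t0T) (Ly _ t0T)) gt// ht.
move=> v Lv; have [G [iG GE dG]] := du v Lv; have [H [iH HE dH]] := de v Lv.
exists (fun t => c * G t + H t); split; first exact: iZD.
  apply: filterS2 GE HE => t gt ht t0T.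
  by rewrite (ipZD _ _ _ (Lu' _ t0T) (Le' _ t0T) Lv) gt// ht.
move=> t t0T; have T00 : 0 <= (0 : R) <= T by apply/andP; split => //; exact: ltW.
rewrite (ipZD _ _ _ (Lu _ t0T) (Le _ t0T) Lv) (ipZD _ _ _ (Lu _ T00) (Le _ T00) Lv).
rewrite (dG t t0T) (dH t t0T).
have sub0 : `[0, t] `<=` (`[0, T] : set R).
  move=> x /=; rewrite !in_itv/= => /andP[-> xt].
  by have /andP[_ tT] := t0T; rewrite (le_trans xt).
have iG' : lam.-integrable `[0, t] (EFin \o G) by exact: integrableS iG.
have iH' : lam.-integrable `[0, t] (EFin \o H) by exact: integrableS iH.
have icG' : lam.-integrable `[0, t] (EFin \o (fun t => c * G t)).
  by have := integrableZl _ c iG'; apply.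
by rewrite RintegralD// RintegralZl//; ring.
Qed.

Lemma time_regularD u u' e e' : time_regular u u' -> time_regular e e' ->
  time_regular (fun t => u t \+ e t) (fun t => u' t \+ e' t).
Proof.
move=> ru re; have := time_regularZD 1 ru re.
by congr time_regular; apply/funext => t; apply/funext => x; rewrite mul1r.
Qed.

Lemma time_regularB u u' e e' : time_regular u u' -> time_regular e e' ->
  time_regular (fun t => u t \- e t) (fun t => u' t \- e' t).
Proof.
move=> ru re; have := time_regularZD (-1) re ru.
by congr time_regular; apply/funext => t; apply/funext => x;
  rewrite mulN1r addrC.
Qed.

Lemma time_regular_energy e e' (g : R -> R) : time_regular e e' ->
  lam.-integrable `[0, T] (EFin \o g) ->
  {ae lam, forall t, 0 <= t <= T -> ip (e' t) (e t) = g t} ->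
  forall t, 0 <= t <= T ->
    L2norm (e t) ^+ 2 = L2norm (e 0) ^+ 2 + 2 * \int[lam]_(x in `[0, t]) g x.
Proof.
move=> [[Le Le'] ce [m im mP] _ de] ig gE.
exact (energy_identity mO Le Le' ce im mP ig gE de).
Qed.

Lemma L2norm_integrable u' n : measurable_fun `[0, T] n ->
  {ae lam, forall t, 0 <= t <= T -> L2norm (u' t) = n t} ->
  Lr_time Omega T 1 L2 u' -> lam.-integrable `[0, T] (EFin \o n).
Proof.
move=> mn nE [_ _ hoo]; apply/integrableP; split; first exact/measurable_EFinP.
apply: le_lt_trans hoo; rewrite le_eqVlt; apply/orP; left; apply/eqP.
apply: ae_eq_integral_any; apply: filterS nE => t nt; rewrite /= in_itv/= => t0T.
by rewrite -nt// ger0_norm ?sqrtr_ge0// expr1.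
Qed.

End time_regular.

(** The first inequality reads (M - D)^2 <= E^2 + Th^2 + D^2 <= (E + Th + D)^2, whence M <= 2 D + E
    + Th. Then r^2 <= E^2 + Th^2 + 4 D^2 + 2 D E + 2 D Th, which is below the square of the
    right-hand side term by term, both square roots being at least 1. *)
Lemma energy_bound_solve (R : realType) (E Th D M r : R) :
  0 <= E -> 0 <= Th -> 0 <= D -> 0 <= M -> 0 <= r ->
  M ^+ 2 <= E ^+ 2 + Th ^+ 2 + 2 * (M * D) ->
  r ^+ 2 <= E ^+ 2 + Th ^+ 2 + 2 * (M * D) ->
  r <= Num.sqrt (3 / 2) * Th + 2 * D + Num.sqrt 2 * E.
Proof.
move=> E0 Th0 D0 M0 r0 HM Hr.
have q2 : Num.sqrt (3 / 2) ^+ 2 = 3 / 2 :> R by rewrite sqr_sqrtr.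
have s2 : Num.sqrt 2 ^+ 2 = 2 :> R by rewrite sqr_sqrtr.
have q1 : 1 <= Num.sqrt (3 / 2) :> R.
  by rewrite -[leLHS]sqrtr1 ler_wsqrtr// ler_pdivlMr// mul1r ler_nat.
have s1 : 1 <= Num.sqrt 2 :> R by rewrite -[leLHS]sqrtr1 ler_wsqrtr// ler1n.
set q := Num.sqrt (3 / 2) in q2 q1 *; set s := Num.sqrt 2 in s2 s1 *.
have MD : M <= 2 * D + E + Th.
  suff : M - D <= E + Th + D by lra.
  have [|h] := leP (M - D) 0; first by move=> /le_trans; apply; rewrite !addr_ge0.
  have h1 := mulr_ge0 E0 Th0; have h2 := mulr_ge0 E0 D0.
  have h3 := mulr_ge0 Th0 D0.
  have h4 : (M - D) ^+ 2 <= (E + Th + D) ^+ 2.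
    rewrite [leLHS](_ : _ = M ^+ 2 - 2 * (M * D) + D ^+ 2); last by ring.
    rewrite [leRHS](_ : _ = E ^+ 2 + Th ^+ 2 + D ^+ 2 +
      2 * (E * Th + E * D + Th * D)); last by ring.
    by lra.
  by move: h4; rewrite ler_pXn2r ?nnegrE ?(ltW h) ?addr_ge0.
have q0 : 0 <= q by lra.
have s0 : 0 <= s by lra.
rewrite -(@ler_pXn2r _ 2)// ?nnegrE ?addr_ge0 ?mulr_ge0//.
apply: le_trans Hr _.
have h1 : M * D <= (2 * D + E + Th) * D by rewrite ler_wpM2r.
have h2 : D * E <= s * (D * E) by rewrite ler_peMl// mulr_ge0.
have h3 : D * Th <= q * (D * Th) by rewrite ler_peMl// mulr_ge0.
have h4 : 0 <= q * s * (E * Th) by rewrite !mulr_ge0.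
have h5 : 0 <= s * (D * E) by rewrite !mulr_ge0.
have h6 : 0 <= q * (D * Th) by rewrite !mulr_ge0.
have -> : (q * Th + 2 * D + s * E) ^+ 2 = q ^+ 2 * Th ^+ 2 + 4 * D ^+ 2 +
    s ^+ 2 * E ^+ 2 + 4 * (q * (D * Th)) + 2 * (q * s * (E * Th)) +
    4 * (s * (D * E)) by ring.
rewrite q2 s2; have := sqr_ge0 Th; have := sqr_ge0 E.
have h7 : (2 * D + E + Th) * D = 2 * D ^+ 2 + D * E + D * Th by ring.
rewrite h7 in h1; lra.
Qed.

Section time_norm.
Context {R : realType} (T : R).
Local Notation lam := (@lebesgue_measure R).
Implicit Types X : R -> R.

Lemma nrm_le X Y : measurable_fun `[0, T] X -> sqi lam `[0, T] Y ->
  (forall t, 0 <= t <= T -> 0 <= X t <= Y t) ->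
  sqi lam `[0, T] X /\ nrm lam `[0, T] X <= nrm lam `[0, T] Y.
Proof.
move=> mX sY XY.
have XY2 t : `[0, T]%classic t -> X t ^+ 2 <= Y t ^+ 2.
  rewrite /= in_itv/= => /XY/andP[X0 XYt].
  by rewrite lerXn2r// ?nnegrE// (le_trans X0).
have sX : sqi lam `[0, T] X.
  apply: integrable_sqi => //; have := sqi_integrable sY.
  apply: le_integrable => //.
    by apply/measurable_EFinP; exact: measurable_funX.
  by move=> t tT; rewrite /= lee_fin !ger0_norm ?sqr_ge0//; exact: XY2.
have XX : iprod lam `[0, T] X X <= iprod lam `[0, T] Y Y.
  have iXX : lam.-integrable `[0, T] (EFin \o (fun t => X t * X t)).
    by have := sqi_mul_integrable _ sX sX; apply.
  have iYY : lam.-integrable `[0, T] (EFin \o (fun t => Y t * Y t)).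
    by have := sqi_mul_integrable _ sY sY; apply.
  exact: (le_Rintegral _ iXX iYY XY2).
by split => //; exact: ler_wsqrtr.
Qed.

Lemma L2S_normE X : sqi lam `[0, T] X ->
  ((\int[lam]_(t in `[0%R, T]) ((X t) ^+ 2)%:E) `^ 2^-1)%E = (nrm lam `[0, T] X)%:E.
Proof.
move=> sX; have iX := sqi_integrable sX.
rewrite -[X in (X `^ _)%E]fineK ?integrable_fin_num//.
rewrite poweR_EFin; congr EFin; rewrite powR12_sqrt//.
by apply: fine_ge0; apply: integral_ge0 => t _; rewrite lee_fin sqr_ge0.
Qed.

(** For measurable [X], failure of [sqi] can only mean an infinite integral. Together with
    [L2S_normE] this splits the estimate into a real inequality and a trivial case. *)
Lemma L2S_norm_infty X : measurable_fun `[0, T] X -> ~ sqi lam `[0, T] X ->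
  ((\int[lam]_(t in `[0%R, T]) ((X t) ^+ 2)%:E) `^ 2^-1)%E = +oo%E.
Proof.
move=> mX sX; have -> : (\int[lam]_(t in `[0%R, T]) ((X t) ^+ 2)%:E = +oo)%E.
  apply/eqP; rewrite -leye_eq leNgt; apply/negP => Xoo.
  by apply: sX; split.
by rewrite poweRyr// invr_neq0.
Qed.


(* [E], [g], [k] stand for ||e||, <e', e>, ||Ud'||, and [X], [Y], [Z] for the norms of
   w - U, Ud and u - U. *)
Lemma energy_argument (E g k X Y Z : R -> R) : 0 < T ->
  {within `[0, T], continuous E} -> (forall t, 0 <= E t) ->
  lam.-integrable `[0, T] (EFin \o g) -> lam.-integrable `[0, T] (EFin \o k) ->
  (forall t, 0 <= k t) ->
  (forall t : R, 0 <= t <= T ->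
    E t ^+ 2 = E 0 ^+ 2 + 2 * \int[lam]_(x in `[0, t]) g x) ->
  sqi lam `[0, T] X -> sqi lam `[0, T] Y -> measurable_fun `[0, T] Z ->
  (forall t : R, 0 <= t <= T -> [/\ 0 <= X t, 0 <= Y t & 0 <= Z t]) ->
  {ae lam, forall t, 0 <= t <= T ->
    2 * g t + Num.max 0 (Z t - X t) ^+ 2 <= (X t + Y t) ^+ 2 + 2 * (k t * E t)} ->
  sqi lam `[0, T] Z /\
  nrm lam `[0, T] Z <= (Num.sqrt (3 / 2) + 1) * nrm lam `[0, T] X +
    Num.sqrt (3 / 2) * nrm lam `[0, T] Y +
    2 * \int[lam]_(t in `[0, T]) k t + Num.sqrt 2 * E 0.
Proof.
move=> T0 cE E0 ig ik k0 EE sX sY mZ XYZ0 ineq.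
have mT : measurable (`[0, T]%classic : set (measurableTypeR R)).
  exact: measurable_itv.
have T0T : 0 <= T <= T by rewrite ltW//= lexx.
have [c cT Hc] := EVT_max (ltW T0) cE; set M := E c in Hc.
have c0T : 0 <= c <= T by move: cT; rewrite in_itv.
pose r (t : R) : R := Num.max 0 (Z t - X t).
have mr : measurable_fun `[0, T] r.
  apply: measurable_maxr; first exact: measurable_cst.
  by apply: measurable_funB => //; exact: sX.1.
have sth : sqi lam `[0, T] (X \+ Y) by exact: sqiD.
pose rhs t := (X t + Y t) ^+ 2 + 2 * M * k t.
have ith : lam.-integrable `[0, T] (EFin \o (fun t => (X t + Y t) ^+ 2)).
  by have := sqi_integrable sth; apply.
have iMk : lam.-integrable `[0, T] (EFin \o (fun t => 2 * M * k t)).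
  by have := integrableZl mT (2 * M) ik; apply.
have i2g : lam.-integrable `[0, T] (EFin \o (fun t => 2 * g t)).
  by have := integrableZl mT 2%R ig; apply.
have irhs : lam.-integrable `[0, T] (EFin \o rhs).
  by have := integrableD mT ith iMk; apply.
(* Replacing [E t] by its maximum [M] makes the right-hand side a nonnegative integrable
   function. *)
have ineqM : {ae lam, forall t, 0 <= t <= T -> 2 * g t + r t ^+ 2 <= rhs t}.
  apply: filterS ineq => t ineq t0T; apply: le_trans (ineq t0T) _.
  rewrite lerD2l -mulrA ler_wpM2l// mulrC ler_wpM2r//.
  by apply: Hc; rewrite in_itv.
(* Integrability of r^2 is a consequence of the inequality itself: r^2 is dominated by [rhs] - 2
   [g]. *)
have ir2 : lam.-integrable `[0, T] (EFin \o (fun t => r t ^+ 2)).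
  have i1 : lam.-integrable `[0, T] (EFin \o (fun t => rhs t - 2 * g t)).
    by have := integrableB mT irhs i2g; apply.
  apply: (ae_le_integrable _ i1); first exact: measurable_funX.
  apply: filterS ineqM => t h t0T; rewrite ger0_norm ?sqr_ge0// lerBrDl.
  exact: h.
have sr : sqi lam `[0, T] r by apply: integrable_sqi.
have r2E : nrm lam `[0, T] r ^+ 2 = \int[lam]_(t in `[0, T]) (r t ^+ 2).
  by rewrite sqr_nrm.
have th2E : nrm lam `[0, T] (X \+ Y) ^+ 2 =
    \int[lam]_(t in `[0, T]) ((X t + Y t) ^+ 2).
  by rewrite sqr_nrm.
pose D := \int[lam]_(t in `[0, T]) k t.
have D0 : 0 <= D by exact: Rintegral_ge0.
have M0 : 0 <= M by exact: E0.
(* At t = c the integral on the left is dropped and M^2 is bounded; at t = T the square of [E] is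
   dropped and the norm of [r] is bounded. *)
have bound (t : R) : 0 <= t <= T ->
    E t ^+ 2 + \int[lam]_(x in `[0, t]) (r x ^+ 2) <=
    E 0 ^+ 2 + nrm lam `[0, T] (X \+ Y) ^+ 2 + 2 * (M * D).
  move=> t0T; have /andP[t0 tT] := t0T.
  have mt : measurable (`[0, t]%classic : set (measurableTypeR R)).
    exact: measurable_itv.
  have sub : `[0, t] `<=` (`[0, T] : set R).
    by move=> x /=; rewrite !in_itv/= => /andP[-> xt]; rewrite (le_trans xt).
  have S (h : R -> R) : lam.-integrable `[0, T] (EFin \o h) ->
      lam.-integrable `[0, t] (EFin \o h).
    by move=> ih; exact: integrableS mT mt sub ih.
  rewrite (EE t t0T) -!addrA lerD2l.
  rewrite th2E (_ : 2 * (M * D) = \int[lam]_(x in `[0, T]) (2 * M * k x)); last first.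
    by rewrite RintegralZl// mulrA.
  rewrite -RintegralD// -RintegralZl//; last exact: S.
  rewrite -RintegralD//; [|exact: S i2g|exact: S ir2].
  apply: (@le_trans _ _ (\int[lam]_(x in `[0, t]) rhs x)).
    apply: ae_le_Rintegral => //.
    - by have := integrableD mt (S _ i2g) (S _ ir2); apply.
    - exact: S.
    apply: filterS ineqM => x h; rewrite /= in_itv/= => /andP[x0 xt]; apply: h.
    by rewrite x0 (le_trans xt).
  have rhs0 x : 0 <= rhs x.
    by apply: addr_ge0; [exact: sqr_ge0|apply: mulr_ge0 => //; exact: mulr_ge0].
  have t0' : (BLeft 0 <= BRight t)%O by rewrite bnd_simp.
  have tT' : (BRight t <= BRight T)%O by rewrite bnd_simp.
  rewrite -subr_ge0 (Rintegral_itvB irhs t0' tT').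
  by apply: Rintegral_ge0 => x _; exact: rhs0.
have r2_ge0 (t : R) : 0 <= \int[lam]_(x in `[0, t]) (r x ^+ 2).
  by apply: Rintegral_ge0 => x _; exact: sqr_ge0.
have HM : M ^+ 2 <= E 0 ^+ 2 + nrm lam `[0, T] (X \+ Y) ^+ 2 + 2 * (M * D).
  by apply: le_trans (bound c c0T); rewrite lerDl.
have Hr : nrm lam `[0, T] r ^+ 2 <=
    E 0 ^+ 2 + nrm lam `[0, T] (X \+ Y) ^+ 2 + 2 * (M * D).
  by rewrite r2E; apply: le_trans (bound T T0T); rewrite lerDr sqr_ge0.
have rbound := energy_bound_solve (E0 0) (nrm_ge0 _ _ _) D0 M0 (nrm_ge0 _ _ _) HM Hr.
(* Z <= r + X by the choice of [r]; this also yields the square-integrability of [Z]. *)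
have [|sZ Zr] := nrm_le mZ (sqiD mT sr sX).
  move=> t t0T; have [X0 _ Z0] := XYZ0 t t0T; rewrite Z0/=.
  by rewrite -lerBlDr le_max lexx orbT.
split => //; apply: le_trans Zr _; apply: le_trans (nrmD mT sr sX) _.
apply: le_trans (lerD rbound (lexx _)) _.
have XY : nrm lam `[0, T] (X \+ Y) <= nrm lam `[0, T] X + nrm lam `[0, T] Y.
  exact: nrmD.
have := ler_wpM2l (sqrtr_ge0 (3 / 2)) XY.
rewrite mulrDr -/D [(Num.sqrt (3 / 2) + 1) * _]mulrDl mul1r => h.
have arith (a b x y D' s : R) : a <= b + y ->
    a + 2 * D' + s + x <= b + x + y + 2 * D' + s by lra.
exact: arith.
Qed.

End time_norm.

Section time_spaces.
Context {R : realType} (d : nat) (Omega : set 'rV[R]_d) (T : R).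
Hypothesis mO : measurable Omega.
Hypothesis T0 : 0 < T.
Local Notation lam := (@lebesgue_measure R).

Lemma continuous_H10_time (u : R -> 'rV[R]_d -> R) :
  continuous_H10 Omega T u -> continuous_time Omega T u.
Proof.
move=> [gu [_ cu]] t t0T; have := cu t t0T; apply: squeeze_cvgr (cvg_cst 0).
apply: nearW => s; rewrite sqrtr_ge0/=.
rewrite -[leLHS](@ger0_norm _ _) ?sqrtr_ge0// -sqrtr_sqr ler_wsqrtr//.
by rewrite lerDl sqr_ge0.
Qed.

Lemma Lipschitz_continuous_time X (u : R -> 'rV[R]_d -> R) :
  Lipschitz_time Omega T X u -> continuous_time Omega T u.
Proof.
move=> [_ [C HC]] t t0T; rewrite /continuous_time_at.
have S : C * `|s - t| @[s --> within `[0, T] (nbhs t)] --> (0 : R).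
  rewrite -[X in _ --> X](mulr0 C); apply: cvgM; first exact: cvg_cst.
  apply: cvg_within_filter.
  have : (s - t : R) @[s --> t] --> t - t by apply: cvgB; [exact: cvg_id|exact: cvg_cst].
  by rewrite subrr => /cvg_norm; rewrite normr0.
apply: (squeeze_cvgr _ (cvg_cst 0) S); rewrite near_withinE; apply: nearW => s.
by rewrite /= in_itv/= => s0T; rewrite sqrtr_ge0/=; exact: HC.
Qed.

Lemma Lr2_time_regular u u' : (forall t, 0 <= t <= T -> L2 Omega (u t)) ->
  continuous_time Omega T u -> Lr_time Omega T 2 (L2 Omega) u' ->
  weak_dt Omega T u u' -> time_regular Omega T u u'.
Proof.
move=> Lu cu [Lu' su' u'oo] wu.
have [n mn nE] := strongly_measurable_L2norm mO su' Lu'.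
have sn : sqi lam `[0, T] n.
  split => //; apply: le_lt_trans u'oo; rewrite le_eqVlt; apply/orP; left.
  apply/eqP/ae_eq_integral_any; apply: filterS nE => t nt.
  by rewrite /= in_itv/= => t0T; rewrite nt.
(* On a bounded interval L_2 is contained in L_1; the majorant is n <= 1 + n^2. *)
have ib : lam.-integrable `[0, T] (EFin \o (fun t => 1 + n t ^+ 2)).
  have i1 : lam.-integrable `[0, T] (EFin \o (fun=> 1 : R)).
    apply: continuous_compact_integrable; first exact: segment_compact.
    by apply: continuous_subspaceT => x; exact: cvg_cst.
  by have := integrableD _ i1 (sqi_integrable sn); apply.
have nP : {ae lam, forall t, 0 <= t <= T -> L2norm Omega (u' t) <= 1 + n t ^+ 2}.
  apply: filterS nE => t nt t0T; rewrite nt//.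
  by have := sqr_ge0 (n t - 1); have := sqr_ge0 (n t); nra.
exact (weak_dt_time_regular mO T0 Lu Lu' cu su' wu ib nP).
Qed.

Lemma Linfty_time_regular X u u' : (forall t, 0 <= t <= T -> L2 Omega (u t)) ->
  (forall v, X v -> L2 Omega v) ->
  continuous_time Omega T u -> Linfty_time Omega T X u' ->
  weak_dt Omega T u u' -> time_regular Omega T u u'.
Proof.
move=> Lu XL cu [Xu' su' [C CE]] wu.
have Lu' t : 0 <= t <= T -> L2 Omega (u' t) by move=> t0T; exact/XL/Xu'.
have ib : lam.-integrable `[0, T] (EFin \o (fun=> C)).
  apply: continuous_compact_integrable; first exact: segment_compact.
  by apply: continuous_subspaceT => x; exact: cvg_cst.
exact (weak_dt_time_regular mO T0 Lu Lu' cu su' wu ib CE).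
Qed.

End time_spaces.

(** * From the energy inequality at almost every time to the estimate in L_2(0,T) *)

Theorem theorem3p7 (R : realType) (d : nat) (hd : d = 2%N \/ d = 3%N)
  (Omega : set 'rV[R]_d) (hOmega : polygonal_domain Omega)
  (T : R) (hT : 0 < T)
  (f : R -> 'rV[R]_d -> R)
  (hf : Linfty_time Omega T (L2 Omega) f)
  (hfc : piecewise_continuous_time Omega T f)
  (Th : mesh Omega) (p : nat) (hp : (1 <= p)%N)
  (a : R -> 'rV[R]_d -> 'M[R]_d) (ha : admissible_coef T a Th)
  (sa : R -> 'rV[R]_d -> 'M[R]_d) (hsa : sqrt_coef Omega T a sa)
  (u0 : 'rV[R]_d -> R) (u u' : R -> 'rV[R]_d -> R)
  (hu0 : L2 Omega u0)
  (hu : weak_solution Omega T a f u0 u u')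
  (B : R -> ('rV[R]_d -> R) -> ('rV[R]_d -> R) -> R)
  (hB : forall t : R, 0 <= t <= T -> bilinear_on Th p (B t))
  (N : R -> ('rV[R]_d -> R) -> R)
  (hN : forall t : R, 0 <= t <= T -> norm_on Th p (N t))
  (hBN : consistent_on_H10 Omega T a sa B N)
  (U U' : R -> 'rV[R]_d -> R)
  (hU : semidiscrete_solution Th p T f B U U')
  (Pi : ('rV[R]_d -> R) -> 'rV[R]_d -> R) (hPi : L2proj Th p Pi)
  (A : R -> ('rV[R]_d -> R) -> 'rV[R]_d -> R)
  (hA : forall t : R, 0 <= t <= T -> discrete_op Th p (B t) (A t))
  (w : R -> 'rV[R]_d -> R)
  (hw : elliptic_reconstruction Omega T f B Pi A U w)
  (Uc Ud Ud' : R -> 'rV[R]_d -> R)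
  (hUcd : conforming_decomposition Th p T U Uc Ud Ud')
  (hmeas_uU : measurable_fun `[0, T] (fun t => N t (u t \- U t)))
  (hmeas_wU : measurable_fun `[0, T] (fun t => N t (w t \- U t)))
  (hmeas_Ud : measurable_fun `[0, T] (fun t => N t (Ud t))) :
  (L2S_norm T N (fun t => u t \- U t)%R
   <= (Num.sqrt (3 / 2) + 1)%:E * L2S_norm T N (fun t => w t \- U t)%R
      + (Num.sqrt (3 / 2))%:E * L2S_norm T N Ud
      + 2%:E * L1L2_norm Omega T Ud'
      + (Num.sqrt 2 * L2norm Omega (u0 \- Uc 0)%R)%:E)%E.
Proof.
have [oO _ bO _ _] := hOmega.
have mO : measurable Omega by exact: open_measurable_rV.
have finO := leb_bounded_fin mO bO.
have [cu Lu' wu u0E hweak] := hu.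
have [[LipU LU'] SU' wU hscheme] := hU.
have [hdec cUd [SUd' sUd' Ud'oo] wUd] := hUcd.
have Hu t : 0 <= t <= T -> H10 Omega (u t).
  by move=> t0T; have [gu [Hgu _]] := cu; exists (gu t); exact: Hgu.
have SU := LipU.
have LUd' t : 0 <= t <= T -> L2 Omega (Ud' t) by move=> /SUd'[].
have ru : time_regular Omega T u u'.
  apply: Lr2_time_regular => //; last exact: continuous_H10_time.
  by move=> t t0T; exact/H10_L2/Hu.
have rU : time_regular Omega T U U'.
  apply: (@Linfty_time_regular _ _ _ _ mO hT (Sh Th p)) => //.
  - by move=> t /SU[].
  - by move=> v [].
  - by apply: (@Lipschitz_continuous_time _ _ _ _ (Sh Th p)); split.
have [k mk kE] := strongly_measurable_L2norm mO sUd' LUd'.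
have ik : (@lebesgue_measure R).-integrable `[0, T] (EFin \o k).
  by apply: (L2norm_integrable mk kE); split.
have kP : {ae (@lebesgue_measure R), forall t, 0 <= t <= T ->
    L2norm Omega (Ud' t) <= k t}.
  by apply: filterS kE => t kt t0T; rewrite kt.
have SUd t : 0 <= t <= T -> Sh Th p (Ud t) by move=> /hdec[].
have rUd : time_regular Omega T Ud Ud'.
  have LUd t : 0 <= t <= T -> L2 Omega (Ud t) by move=> /SUd[].
  exact (weak_dt_time_regular mO hT LUd LUd' cUd sUd' wUd ik kP).
have re := time_regularD mO hT (time_regularB mO hT ru rU) rUd.
pose e t := u t \- U t \+ Ud t; pose e' t := u' t \- U' t \+ Ud' t.
have [[Le Le'] ce _ pair _] := re.
have [g ig gE] := pair e ce Le.
have EE := time_regular_energy mO re ig gE.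
(* [k] equals ||U_d'|| only almost everywhere and may be negative on a null set; [energy_argument]
   wants a function nonnegative at every time. *)
have iak : (@lebesgue_measure R).-integrable `[0, T] (EFin \o (fun t => `|k t|)).
  exact: integrable_norm.
have kE' : {ae (@lebesgue_measure R), forall t, 0 <= t <= T ->
    L2norm Omega (Ud' t) = `|k t|}.
  by apply: filterS kE => t kt t0T; rewrite -kt// ger0_norm// sqrtr_ge0.
have L1E : L1L2_norm Omega T Ud' = (\int[@lebesgue_measure R]_(t in `[0, T]) `|k t|)%:E.
  rewrite /Rintegral fineK; last exact: integrable_fin_num.
  apply: ae_eq_integral_any; apply: filterS kE' => t kt.
  by rewrite /= in_itv/= => t0T; rewrite kt.
have Hw t : 0 <= t <= T -> H10 Omega (w t) by move=> /hw[].
have HUc t : 0 <= t <= T -> H10 Omega (Uc t) by move=> /hdec[].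
have UdE t : 0 <= t <= T -> eq_on Omega (Ud t) (U t \- Uc t) by move=> /hdec[].
(* [U 0] cancels between -U(0) and U_d(0) = U(0) - U_c(0), so the initial error involves only the
   conforming part. *)
have e0E : L2norm Omega (e 0) = L2norm Omega (u0 \- Uc 0)%R.
  have T00 : 0 <= (0 : R) <= T by apply/andP; split => //; exact: ltW.
  apply: nrm_ae; apply: filterS2 u0E (UdE 0 T00) => x u0x Udx Ox.
  by rewrite /e /= Udx//= u0x//; ring.
have [Lf _ _] := hf; have [Lu'L _ _] := Lu'; have [SU'S _ _] := SU'.
have BNsym := consistent_symmetric ha hsa hBN.
pose X t := N t (w t \- U t); pose Y t := N t (Ud t); pose Z t := N t (u t \- U t).
have ineq : {ae (@lebesgue_measure R), forall t, 0 <= t <= T ->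
    2 * ip Omega (e' t) (e t) + Num.max 0 (Z t - X t) ^+ 2 <=
    (X t + Y t) ^+ 2 + 2 * (L2norm Omega (Ud' t) * L2norm Omega (e t))}.
  (* Three null sets of times are discarded: those of the weak equation, of the scheme and of the
     symmetry of [B]. *)
  apply: filterS3 hweak hscheme BNsym => t weakt schemet BNt t0T.
  have Hut := Hu t t0T; have Hwt := Hw t t0T; have SUt := SU t t0T.
  have [SPf PfE] := hPi (f t) (Lf t t0T).
  have [SAU AUE] := (hA t t0T) (U t) SUt.
  have symB v z : H10 Omega v -> H10 Omega z -> B t v z = B t z v.
    by move=> Hv Hz; exact: (BNt t0T v z Hv Hz).1.
  have NB v : H10 Omega v -> N t v ^+ 2 = B t v v.
    by move=> Hv; exact: (BNt t0T v v Hv Hv).2.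
  have weak v : H10 Omega v -> ip Omega (u' t) v + B t (u t) v = ip Omega (f t) v.
    move=> [gv Hgv]; have [gu Hgu] := Hut.
    by rewrite (hBN t _ _ _ _ t0T Hgu Hgv).1; exact: weakt.
  exact (energy_inequality mO finO (hB t t0T) (hN t t0T) symB NB Hut Hwt SUt
    (HUc t t0T) (SUd t t0T) (UdE t t0T) (Lu'L t t0T) (SU'S t t0T) (LUd' t t0T)
    (Lf t t0T) SPf SAU weak (schemet t0T) PfE AUE (hw t t0T).2).
have Ineq : {ae (@lebesgue_measure R), forall t, 0 <= t <= T ->
    2 * g t + Num.max 0 (Z t - X t) ^+ 2 <=
    (X t + Y t) ^+ 2 + 2 * (`|k t| * L2norm Omega (e t))}.
  apply: filterS3 gE kE' ineq => t gt kt it t0T.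
  by rewrite -(gt t0T) -(kt t0T); exact: it.
have XYZ0 t : 0 <= t <= T -> [/\ 0 <= X t, 0 <= Y t & 0 <= Z t].
  move=> t0T; have [_ N0 _ _ _] := hN t t0T.
  have SUt := SU t t0T; have Hut := Hu t t0T; have Hwt := Hw t t0T.
  have SHB v : H10 Omega v -> SH Th p (v \- U t).
    move=> Hv; have := SH_add mO (ShB mO (ShB mO SUt SUt) SUt) Hv.
    by congr SH; apply/funext => x /=; rewrite subrr sub0r addrC.
  have SHUd := Sh_SH mO finO (SUd t t0T) Hut.
  by split; apply: N0 => //; exact: SHB.
have nN (x : \bar R) : (0 <= x)%E -> x != -oo%E by case: x.
have q0 : 0 < Num.sqrt (3 / 2) :> R by rewrite sqrtr_gt0 divr_gt0.
have q1 : 0 < Num.sqrt (3 / 2) + 1 :> R by rewrite addr_gt0.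
have L2S0 V : (0 <= L2S_norm T N V)%E by exact: poweR_ge0.
have c1 V : (0 <= (Num.sqrt (3 / 2) + 1)%:E * L2S_norm T N V)%E.
  by apply: mule_ge0 => //; rewrite lee_fin ltW.
have c2 : (0 <= (Num.sqrt (3 / 2))%:E * L2S_norm T N Ud)%E.
  by apply: mule_ge0 => //; rewrite lee_fin ltW.
have c3 : (0 <= 2%:E * L1L2_norm Omega T Ud')%E.
  by apply: mule_ge0 => //; apply: integral_ge0 => t _; rewrite lee_fin sqrtr_ge0.
have c4 : (0 <= (Num.sqrt 2 * L2norm Omega (u0 \- Uc 0)%R)%:E)%E.
  by rewrite lee_fin mulr_ge0 ?sqrtr_ge0.
(* If one of the first two norms on the right is infinite, so is the whole right-hand side: the
   other summands are nonnegative, hence different from -oo. *)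
have [sX|sX] := pselect (sqi (@lebesgue_measure R) `[0, T] X); last first.
  have -> : L2S_norm T N (fun t => w t \- U t)%R = +oo%E.
    exact: L2S_norm_infty hmeas_wU sX.
  by rewrite gt0_muley ?lte_fin// !addye ?leey ?nN.
have [sY|sY] := pselect (sqi (@lebesgue_measure R) `[0, T] Y); last first.
  have -> : L2S_norm T N Ud = +oo%E by exact: L2S_norm_infty hmeas_Ud sY.
  by rewrite gt0_muley ?lte_fin// addey ?nN// !addye ?leey ?nN.
have [sZ] := energy_argument hT (continuous_time_L2norm mO ce Le)
  (fun t => sqrtr_ge0 _) ig iak (fun t => normr_ge0 _) EE sX sY hmeas_uU XYZ0 Ineq.
rewrite e0E => Zle.
have -> : L2S_norm T N (fun t => u t \- U t)%R = _ := L2S_normE sZ.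
have -> : L2S_norm T N (fun t => w t \- U t)%R = _ := L2S_normE sX.
have -> : L2S_norm T N Ud = _ := L2S_normE sY.
by rewrite L1E -!EFinM -!EFinD lee_fin.
Qed.
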